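(* Let $\epsilon>0$. Let $X=\{x\in\mathbb{R}^n:Ax\le b\}$ be a rational polyhedron with at least one vertex, let $Y=\{x\in\mathbb{R}^n:Cx\le d\}$ be a rational polyhedron with at least one vertex and $X\subseteq Y$, and let $\phi:Y\to\mathbb{R}_+$, $\phi(x)=\sum_{i=1}^n\phi_i(x_i)$, be a separable concave function whose components $\phi_i$ are nonnegative. Let $\psi=\sum_{i=1}^n\psi_i$ be the piecewise-linear function constructed from $\phi,A,b,C,d,\epsilon$ as described in the context. Let $Z^*_{\mathrm{conc}}=\min\{\phi(x):Ax\le b\}$ and $Z^*_{\mathrm{pwl}}=\min\{\psi(x):Ax\le b\}$. Then $$Z^*_{\mathrm{conc}}\le Z^*_{\mathrm{pwl}}\le(1+\epsilon)Z^*_{\mathrm{conc}}.$$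
   Context: Sizes: for an integer $r$, $\mathrm{size}(r)=1+\lceil\log_2(|r|+1)\rceil$; for a rational $r=r_1/r_2$ with $r_2>0$ and $r_1,r_2$ coprime integers, $\mathrm{size}(r)=\mathrm{size}(r_1)+\mathrm{size}(r_2)$; for a rational vector or matrix $M\in\mathbb{Q}^{p\times q}$ with entries $m_{ij}$, $\mathrm{size}(M)=pq+\sum_{i,j}\mathrm{size}(m_{ij})$. Let $V(A,b)=4(\mathrm{size}(A)+\mathrm{size}(b))$ and $V(C,d)=4(\mathrm{size}(C)+\mathrm{size}(d))$. $\mathrm{proj}_{x_i}Y$ is the projection of $Y$ on the $i$-th coordinate; it is the domain of the concave function $\phi_i$. ''Slope'' of $\phi_i$ at a point means its derivative, or the right derivative where the derivative does not exist; the tangent at a point is the line through that point of the graph with that slope. Choice of parameters. If $\mathrm{proj}_{x_i}Y=[\alpha_i',\beta_i']$, let $[\alpha_i,\beta_i]=[\alpha_i',\beta_i']$; if it is $[\alpha_i',+\infty)$, let $[\alpha_i,\beta_i]=[\alpha_i',2^{V(A,b)-1}]$; if it is $(-\infty,\beta_i']$, let $[\alpha_i,\beta_i]=[-2^{V(A,b)-1},\beta_i']$; if it is $\mathbb{R}$, let $[\alpha_i,\beta_i]=[-2^{V(A,b)},2^{V(A,b)}]$. If $\mathrm{proj}_{x_i}Y$ is a closed interval or a half-line, let $$l_i=\frac{1}{2^{V(A,b)+V(C,d)-1}-1},\qquad u_i=2^{V(A,b)-1}+2^{V(C,d)-1}-1;$$ if it is $\mathbb{R}$, let $l_i=2^{V(A,b)-1}$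 and $u_i=3\cdot2^{V(A,b)-1}$. Standing assumption: for each $i$ the interval $[\alpha_i+l_i,\alpha_i+u_i]\cap[\beta_i-u_i,\beta_i-l_i]$ is nonempty. Construction of $\psi_i$. Let $l_i'=\max\{l_i,\beta_i-u_i-\alpha_i\}$, $u_i'=\min\{u_i,\beta_i-l_i-\alpha_i\}$ and $q=1+4\epsilon+4\epsilon^2$. (Tangents from the left.) If the slope of $\phi_i$ at $\alpha_i+l_i'$ is nonnegative, introduce tangents to $\phi_i$ at $\alpha_i+l_i'q^k$ for $k=0,\dots,Q_i$, where $Q_i$ is the largest integer such that $\alpha_i+l_i'q^{Q_i}\le\alpha_i+u_i'$ and the slope at $\alpha_i+l_i'q^{Q_i}$ is nonnegative. Let $\zeta_i=\min\{\alpha_i+u_i',\alpha_i+l_i'q^{Q_i+1}\}$. If the slope at $\zeta_i$ is nonnegative, introduce an additional tangent at $\zeta_i$; otherwise let $r_i$ be the largest integer such that the slope at $\alpha_i+l_i'q^{Q_i}(1+\epsilon)^{r_i}$ is nonnegative, and introduce an additional tangent at that point. If the slope at $\alpha_i+l_i'$ is negative, no tangents are introduced from the left. (Tangents from the right.) Symmetrically, if the slope at $\beta_i-l_i'$ is nonpositive, introduce tangents at $\beta_i-l_i'q^k$ for $k=0,\dots,R_i$, where $R_i$ is the largest integer such that $\beta_i-l_i'q^{R_i}\ge\beta_i-u_i'$ and the slope at $\beta_i-l_i'q^{R_i}$ is nonpositive. Let $\eta_i=\max\{\beta_i-u_i',\beta_i-l_i'q^{R_i+1}\}$. If the slope at $\eta_i$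 is nonpositive, introduce an additional tangent at $\eta_i$; otherwise let $t_i$ be the largest integer such that the slope at $\beta_i-l_i'q^{R_i}(1+\epsilon)^{t_i}$ is nonpositive, and introduce an additional tangent at that point. If the slope at $\beta_i-l_i'$ is positive, no tangents are introduced from the right. (Endpoints.) For each of $\alpha_i,\beta_i$ lying in the interior of $\mathrm{proj}_{x_i}Y$, introduce one more tangent at that point. For each of $\alpha_i,\beta_i$ that is an endpoint of $\mathrm{proj}_{x_i}Y$, set $\psi_i$ equal to $\phi_i$ at that point. At all other points of $\mathrm{proj}_{x_i}Y$, $\psi_i(x_i)$ is the minimum of the values at $x_i$ of all introduced tangent lines. Finally $\psi(x)=\sum_{i=1}^n\psi_i(x_i)$. *)

(* Defs.v *)
From HB Require Import structures.
From mathcomp Require Export all_boot all_order all_algebra.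
From mathcomp Require Export all_classical all_reals all_analysis.

Set Implicit Arguments.
Unset Strict Implicit.
Unset Printing Implicit Defensive.

Import Order.TTheory GRing.Theory Num.Theory.
Import numFieldNormedType.Exports.

Local Open Scope classical_set_scope.
Local Open Scope ring_scope.

(* [up_log 2 m] is the ceiling of [log_2 m] for [0 < m]. *)
Definition int_size (z : int) : nat := (1 + up_log 2 `|z|.+1)%N.

(* [numq] and [denq] are coprime and [denq] is positive. *)
Definition rat_size (r : rat) : nat := (int_size (numq r) + int_size (denq r))%N.

Definition mx_size p q (M : 'M[rat]_(p, q)) : nat :=
  (p * q + \sum_(i < p) \sum_(j < q) rat_size (M i j))%N.

Definition system_size m n (A : 'M[rat]_(m, n)) (b : 'cV[rat]_m) : nat :=
  (4 * (mx_size A + mx_size b))%N.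

Definition polyhedron (R : realType) m n (A : 'M[rat]_(m, n)) (b : 'cV[rat]_m)
    : set 'cV[R]_n :=
  [set x | forall i, (map_mx ratr A *m x) i ord0 <= ratr (b i ord0)].

Definition vertex (R : realType) n (P : set 'cV[R]_n) (v : 'cV[R]_n) : Prop :=
  P v /\ forall (y z : 'cV[R]_n) (t : R),
    P y -> P z -> y <> v -> z <> v -> 0 <= t <= 1 ->
    v <> t *: y + (1 - t) *: z.

Definition proj (R : realType) n (i : 'I_n) (Y : set 'cV[R]_n) : set R :=
  [set x i ord0 | x in Y].

Definition concave_on (R : realType) (D : set R) (f : R -> R) : Prop :=
  @convex_function R R^o D (fun x => - f x).

Definition separable (R : realType) n (f : 'I_n -> R -> R) (x : 'cV[R]_n) : R :=
  \sum_(i < n) f i (x i ord0).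

Definition is_minimum (R : realType) T (S : set T) (f : T -> R) (z : R) : Prop :=
  (f @` S) z /\ lbound (f @` S) z.

(* Meaningful at interior points of the domain of a concave [f], where it only
   depends on the restriction of [f] to its domain. *)
Definition slope (R : realType) (f : R -> R) (p : R) : R :=
  if `[< derivable f p 1 >] then derive1 f p
  else lim ((fun h : R => h^-1 * (f (p + h) - f p)) @ 0^'+).

Definition tangent (R : realType) (f : R -> R) (p x : R) : R :=
  f p + slope f p * (x - p).

(* Wherever this contributes to [psi] below, [P 0] holds and [P] is bounded above,
   so this is also the largest integer satisfying the property. *)
Definition largest (P : nat -> Prop) : nat :=
  xget 0%N [set k | P k /\ forall j, P j -> (j <= k)%N].

Definition seq_min (R : realType) (s : seq R) : R :=
  \big[Num.min/head 0 s]_(y <- behead s) y.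

Section one_coordinate.
Context (R : realType).

(* [S] is the domain of [phi]; [V] and [W] are the values [system_size A b] and
   [system_size C d].  When [S] is the projection of a nonempty polyhedron it is
   closed and convex, so that [inf S] and [sup S], when finite, are its
   endpoints, and it is unbounded on both sides only if it is [setT].  The
   exponents [V.-1] and [W.-1] are genuine differences, since [V] and [W] are
   positive whenever the systems have a row and a column. *)
Context (S : set R) (V W : nat) (phi : R -> R) (e : R).

Definition alpha : R :=
  if `[< S = setT >] then - 2 ^+ V
  else if `[< has_lbound S >] then inf S else - 2 ^+ V.-1.

Definition beta : R :=
  if `[< S = setT >] then 2 ^+ V
  else if `[< has_ubound S >] then sup S else 2 ^+ V.-1.

Definition ell : R :=
  if `[< S = setT >] then 2 ^+ V.-1 else 1 / (2 ^+ (V + W).-1 - 1).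

Definition upp : R :=
  if `[< S = setT >] then 3 * 2 ^+ V.-1 else 2 ^+ V.-1 + 2 ^+ W.-1 - 1.

Definition compatible : Prop :=
  `[alpha + ell, alpha + upp] `&` `[beta - upp, beta - ell] !=set0.

Definition ell' : R := Num.max ell (beta - upp - alpha).

Definition upp' : R := Num.min upp (beta - ell - alpha).

Definition ratio : R := 1 + 4 * e + 4 * e ^+ 2.

Definition lpt (k : nat) : R := alpha + ell' * ratio ^+ k.

Definition Qmax : nat :=
  largest (fun k => lpt k <= alpha + upp' /\ 0 <= slope phi (lpt k)).

Definition zeta : R := Num.min (alpha + upp') (lpt Qmax.+1).

Definition lpt_fine (r : nat) : R := alpha + ell' * ratio ^+ Qmax * (1 + e) ^+ r.

(* No upper bound is imposed on the points here, hence the requirement that the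
   point lie where the slope of [phi] is defined. *)
Definition rmax : nat :=
  largest (fun r => interior S (lpt_fine r) /\ 0 <= slope phi (lpt_fine r)).

Definition left_points : seq R :=
  if 0 <= slope phi (alpha + ell') then
    rcons [seq lpt k | k <- iota 0 Qmax.+1]
      (if 0 <= slope phi zeta then zeta else lpt_fine rmax)
  else [::].

Definition rpt (k : nat) : R := beta - ell' * ratio ^+ k.

Definition Rmax : nat :=
  largest (fun k => beta - upp' <= rpt k /\ slope phi (rpt k) <= 0).

Definition eta : R := Num.max (beta - upp') (rpt Rmax.+1).

Definition rpt_fine (t : nat) : R := beta - ell' * ratio ^+ Rmax * (1 + e) ^+ t.

Definition tmax : nat :=
  largest (fun t => interior S (rpt_fine t) /\ slope phi (rpt_fine t) <= 0).

Definition right_points : seq R :=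
  if slope phi (beta - ell') <= 0 then
    rcons [seq rpt k | k <- iota 0 Rmax.+1]
      (if slope phi eta <= 0 then eta else rpt_fine tmax)
  else [::].

Definition end_points : seq R := [seq p <- [:: alpha; beta] | `[< interior S p >]].

Definition tangent_points : seq R := left_points ++ right_points ++ end_points.

(* [compatible] makes [tangent_points] nonempty, so the default value of
   [seq_min] is irrelevant. *)
Definition psi (x : R) : R :=
  if `[< (x = alpha \/ x = beta) /\ ~ interior S x >] then phi x
  else seq_min [seq tangent phi p x | p <- tangent_points].

End one_coordinate.

(* Main.v *)
(* A concave function that is bounded below on a pointed polyhedron is minimized
   at a basic point, i.e. a point whose active constraints have full column rank:
   from any other point one can move along a line in the kernel of the active
   constraints, without increasing the function, until a new constraint becomes
   active.  Both phi and psi are of this kind, so it suffices to compare them at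
   the basic points of X.  By Cramer's rule and a bound on minors, the coordinates
   of basic points of X and Y are fractions with numerator and denominator at most
   2^(V/4), resp. 2^(W/4).  Hence each coordinate of a basic point of X is either
   an endpoint of the projection of Y, where psi_i = phi_i, or lies in the window
   [alpha_i + l_i', alpha_i + u_i'] on which the tangents are spaced so that psi_i
   is within a factor 1 + epsilon of phi_i.  Only the supergradient inequality is
   used about slopes, and it gives phi <= psi as well. *)

Require Import Defs.
From mathcomp Require Import perm zify ring lra.

Set Implicit Arguments.
Unset Strict Implicit.
Unset Printing Implicit Defensive.

Import Order.TTheory GRing.Theory Num.Theory.
Import numFieldNormedType.Exports.

Local Open Scope classical_set_scope.
Local Open Scope ring_scope.

(** * Minima at basic points *)

Definition concave_in (R : realType) n (P : set 'cV[R]_n) (g : 'cV[R]_n -> R) :=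
  forall x y t, P x -> P y -> 0 <= t <= 1 ->
    t * g x + (1 - t) * g y <= g (t *: x + (1 - t) *: y).

Lemma not_row_full_ker (F : fieldType) p q (B : 'M[F]_(p, q)) :
  ~~ row_full B -> exists2 v : 'cV[F]_q, v != 0 & B *m v = 0.
Proof.
move=> nB; have : cokermx B != 0.
  rewrite -mxrank_eq0 mxrank_coker -lt0n subn_gt0 ltn_neqAle rank_leq_col andbT.
  by move: nB; rewrite /row_full.
move=> cB; case: (pickP (fun j => col j (cokermx B) != 0)) => [j nj|h].
  exists (col j (cokermx B)) => //.
  by rewrite colE mulmxA mulmx_coker mul0mx.
case/eqP: cB; apply/matrixP => i j; rewrite mxE.
by have /negbFE/eqP/matrixP/(_ i ord0) := h j; rewrite !mxE.
Qed.

Section Basic.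
Context (R : realType) (m n : nat) (M : 'M[R]_(m, n)) (c : 'cV[R]_m).

Let P : set 'cV[R]_n := [set x | forall i, (M *m x) i ord0 <= c i ord0].

Definition active (x : 'cV[R]_n) : {set 'I_m} :=
  [set i | (M *m x) i ord0 == c i ord0]%SET.

(** Inactive rows are zeroed instead of deleted, so the matrix keeps its dimensions while the active
    set varies. *)
Definition active_mx (x : 'cV[R]_n) : 'M[R]_(m, n) :=
  \matrix_(i, j) (if i \in active x then M i j else 0).

Definition basic (x : 'cV[R]_n) : Prop := P x /\ row_full (active_mx x).

Lemma active_mxE x (v : 'cV[R]_n) i :
  (active_mx x *m v) i ord0 = if i \in active x then (M *m v) i ord0 else 0.
Proof.
rewrite !mxE; case: ifP => h; last by apply: big1 => j _; rewrite mxE h mul0r.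
by apply: eq_bigr => j _; rewrite mxE h.
Qed.

Lemma mulmxDZ x (v : 'cV[R]_n) t i :
  (M *m (x + t *: v)) i ord0 = (M *m x) i ord0 + t * (M *m v) i ord0.
Proof. by rewrite mulmxDr -scalemxAr !mxE. Qed.

(** Ratio test of the simplex method: the step is the least quotient of slack by growth over the
    rows that grow along [v]. Active rows do not change along [v], and the minimizing row becomes
    active. *)
Lemma ray_hits_constraint x (v : 'cV[R]_n) i0 : P x -> active_mx x *m v = 0 ->
  0 < (M *m v) i0 ord0 ->
  exists t, [/\ 0 < t, P (x + t *: v) & active x \proper active (x + t *: v)].
Proof.
move=> Px xv hi0.
pose F i := (c i ord0 - (M *m x) i ord0) / (M *m v) i ord0.
case: (@arg_minP _ _ _ i0 (fun i => 0 < (M *m v) i ord0) F hi0) => i /= hi imin.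
have act k : k \in active x -> (M *m v) k ord0 = 0.
  by move=> hk; have := active_mxE x v k; rewrite hk xv => <-; rewrite mxE.
have ni : i \notin active x by apply/negP => /act h; move: hi; rewrite h ltxx.
have Fi : 0 < F i.
  rewrite divr_gt0// subr_gt0 lt_neqAle Px andbT.
  by move: ni; rewrite inE.
exists (F i); split=> //.
  move=> k; rewrite mulmxDZ -lerBrDl.
  have [hk|hk] := ltP 0 ((M *m v) k ord0).
    by rewrite -ler_pdivlMr//; exact: imin.
  by rewrite (@le_trans _ _ 0)// ?subr_ge0//; rewrite mulr_ge0_le0// ltW.
apply/properP; split.
  apply/fintype.subsetP => k hk; rewrite inE mulmxDZ act// mulr0 addr0.
  by move: hk; rewrite inE.
exists i => //; rewrite inE mulmxDZ /F divfK ?(lt0r_neq0 hi)//.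
by rewrite addrC subrK.
Qed.

Lemma concave_in_line g x v s t : concave_in P g -> 0 < s -> 0 < t ->
  P (x + t *: v) -> P (x + s *: - v) ->
  s * g (x + t *: v) + t * g (x + s *: - v) <= (s + t) * g x.
Proof.
move=> cg s0 t0 P1 P2; have st0 : 0 < s + t by rewrite addr_gt0.
have l01 : 0 <= s / (s + t) <= 1.
  by rewrite (divr_ge0 (ltW s0) (ltW st0))/= ler_pdivrMr// mul1r lerDl ltW.
have := cg _ _ _ P1 P2 l01.
have -> : 1 - s / (s + t) = t / (s + t) by field; rewrite gt_eqF.
have -> : s / (s + t) *: (x + t *: v) + t / (s + t) *: (x + s *: - v) = x.
  by apply/matrixP => i j; rewrite !mxE; field; rewrite gt_eqF.
rewrite -(ler_pM2l st0); congr (_ <= _).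
by field; rewrite gt_eqF.
Qed.

(** If [g] rises towards the constraint hit along [v], concavity makes it fall along [- v]. That ray
    must hit a constraint too, for otherwise [g] would drop below [B]. *)
Lemma increase_active g B x (v : 'cV[R]_n) :
  concave_in P g -> (forall y, P y -> B <= g y) ->
  P x -> active_mx x *m v = 0 -> M *m v != 0 ->
  exists y, [/\ P y, g y <= g x & active x \proper active y].
Proof.
move=> cg gB Px.
wlog [i0 hi0] : v / exists i, 0 < (M *m v) i ord0.
  move=> wl xv Mv.
  have [i hi] : exists i, (M *m v) i ord0 != 0.
    apply/existsP; apply: contraNT Mv; rewrite negb_exists => /forallP h.
    apply/eqP/matrixP => i j; rewrite (ord1 j) [RHS]mxE.
    by have := h i; rewrite negbK => /eqP.
  case: (ltgtP 0 ((M *m v) i ord0)) => hi'.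
  - by apply: (wl v) => //; exists i.
  - apply: (wl (- v)).
    + by exists i; rewrite mulmxN mxE oppr_gt0.
    + by rewrite mulmxN xv oppr0.
    + by rewrite mulmxN oppr_eq0.
  - by rewrite -hi' eqxx in hi.
move=> xv Mv.
have [t [t0 Py xy]] := ray_hits_constraint Px xv hi0.
have [gy|gy] := leP (g (x + t *: v)) (g x); first by exists (x + t *: v).
have [[i1 hi1]|neg] := pselect (exists i, 0 < (M *m - v) i ord0).
  have xNv : active_mx x *m (- v) = 0 by rewrite mulmxN xv oppr0.
  have [s [s0 Pz xz]] := ray_hits_constraint Px xNv hi1.
  exists (x + s *: - v); split=> //.
  have := concave_in_line cg s0 t0 Py Pz; nra.
have Ps s : 0 < s -> P (x + s *: - v).
  move=> s0 i; rewrite mulmxDZ (le_trans _ (Px i))// gerDl.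
  rewrite pmulr_rle0// leNgt; apply/negP => h; apply: neg; by exists i.
(* With this length the chord inequality gives [t * (g x - g z) > t * (g x - B)] at the far point
   [z], hence [g z < B]. *)
pose s := t * (g x - B) / (g (x + t *: v) - g x) + 1.
have dg : 0 < g (x + t *: v) - g x by rewrite subr_gt0.
have s0 : 0 < s.
  rewrite ltr_wpDl// divr_ge0 ?(ltW dg)// mulr_ge0 ?(ltW t0)//.
  by rewrite subr_ge0 gB.
have := concave_in_line cg s0 t0 Py (Ps s s0).
have hB := gB _ (Ps s s0).
have : s * (g (x + t *: v) - g x) = t * (g x - B) + (g (x + t *: v) - g x).
  by rewrite /s; field; rewrite gt_eqF.
nra.
Qed.

(** Induction on the number of inactive constraints. Full column rank of [M] guarantees that a
    nonzero direction in the kernel of the active rows changes some other row. *)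
Lemma basic_below g B x : row_full M -> concave_in P g ->
  (forall y, P y -> B <= g y) -> P x -> exists2 v, basic v & g v <= g x.
Proof.
move=> Mfull cg gB.
have [k] := ubnP (m - #|active x|); elim: k x => // k IH x hk Px.
have [xfull|/not_row_full_ker[v v0 xv]] := boolP (row_full (active_mx x)).
  by exists x.
have Mv : M *m v != 0.
  apply: contra v0 => /eqP Mv; have /row_fullP[N NM] := Mfull.
  by rewrite -(mul1mx v) -NM -mulmxA Mv mulmx0.
have [y [Py gyx xy]] := increase_active cg gB Px xv Mv.
have [|w bw gw] := IH y _ Py; last by exists w => //; exact: le_trans gw gyx.
have := proper_card xy; have := max_card (active y); rewrite card_ord.
by move: hk; lia.
Qed.

(** Indexing by functions into the rows makes the candidates a finite family. A singular selection
    gives a meaningless point, harmless because only basic points are compared. *)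
Definition basis_point (f : {ffun 'I_n -> 'I_m}) : 'cV[R]_n :=
  invmx (rowsub f M) *m rowsub f c.

Lemma basicP x : basic x -> exists f : {ffun 'I_n -> 'I_m},
  [/\ injective f, rowsub f M \in unitmx & x = basis_point f].
Proof.
move=> [Px xfull]; exists (fullrankfun xfull).
set f := fullrankfun xfull.
have uf := fullrowsub_unit xfull; rewrite -/f in uf.
have fact i : f i \in active x.
  apply/negPn/negP => h; have : row i (rowsub f (active_mx x)) = 0.
    by apply/matrixP => a b; rewrite !mxE (negbTE h).
  move=> r0.
  have : row i (rowsub f (active_mx x) *m invmx (rowsub f (active_mx x))) = 0.
    by rewrite row_mul r0 mul0mx.
  rewrite mulmxV// => /matrixP/(_ ord0 i); rewrite !mxE eqxx => /eqP.
  by rewrite oner_eq0.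
have e : rowsub f (active_mx x) = rowsub f M.
  by apply/matrixP => a b; rewrite !mxE fact.
rewrite e in uf; split=> //; first exact: fullrankfun_inj.
apply: (canRL (mulKmx uf)).
apply/matrixP => i j; rewrite (ord1 j) mul_rowsub_mx !mxE.
by have := fact i; rewrite inE !mxE => /eqP.
Qed.

(** Only finitely many points are basic, so one of them has the least value among them, and
    [basic_below] extends this to all of [P]. *)
Lemma basic_minimum g B : row_full M -> concave_in P g ->
  (forall y, P y -> B <= g y) -> P !=set0 ->
  exists2 v, basic v & lbound (g @` P) (g v).
Proof.
move=> Mfull cg gB [x0 Px0].
have [v0 bv0 _] := basic_below Mfull cg gB Px0.
have [f0 [_ _ ef0]] := basicP bv0.
have bf0 : `[< basic (basis_point f0) >] by rewrite -ef0; apply/asboolP.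
case: (@arg_minP _ _ _ f0 (fun f => `[< basic (basis_point f) >])
  (fun f => g (basis_point f)) bf0) => f /asboolP bf fmin.
exists (basis_point f) => // _ [x Px <-].
have [v bv gv] := basic_below Mfull cg gB Px.
have [h [_ _ eh]] := basicP bv.
by apply: le_trans gv; rewrite eh; apply: fmin; rewrite -eh; apply/asboolP.
Qed.

(** A nonzero kernel vector of [M] would put a whole line through [v] inside [P], with [v] as the
    midpoint of two other points. *)
Lemma vertex_row_full v : vertex P v -> row_full M.
Proof.
move=> [Pv vP]; apply/negPn/negP => /not_row_full_ker[w w0 Mw].
have Pw s : P (v + s *: w) by move=> i; rewrite mulmxDZ Mw [X in _ * X]mxE mulr0 addr0.
have nw s : s != 0 -> v + s *: w <> v.
  move=> s0 /eqP; rewrite -subr_eq0 addrAC subrr add0r scaler_eq0 (negbTE s0).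
  by rewrite (negbTE w0).
have h : (0 : R) <= 2^-1 <= (1 : R) by lra.
apply: (vP (v + 1 *: w) (v + (-1) *: w) 2^-1) => //.
- by apply: nw; rewrite oner_eq0.
- by apply: nw; rewrite oppr_eq0 oner_eq0.
- by apply/matrixP => i j; rewrite !mxE; field.
Qed.

End Basic.

(** * Size of basic points *)

(** Cramer's rule without division, from the adjugate: expanding the right-hand determinant along
    column [i] meets the cofactors of [B], where that column is deleted anyway. *)
Lemma cramer (F : comPzRingType) n (B : 'M[F]_n) (x c : 'cV[F]_n) i :
  B *m x = c ->
  \det B * x i ord0 = \det (\matrix_(k, j) (if j == i then c k ord0 else B k j)).
Proof.
move=> Bx; have := congr1 (fun y => (\adj B *m y) i ord0) Bx.
rewrite mulmxA mul_adj_mx mul_scalar_mx [X in X = _]mxE => ->.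
rewrite (expand_det_col _ i) mxE; apply: eq_bigr => k _.
rewrite !mxE eqxx mulrC; congr (_ * _).
rewrite /cofactor; congr (_ * \det _); apply/matrixP => a j.
by rewrite !mxE eq_sym (negbTE (neq_lift _ _)).
Qed.

(** Expanding the product of row sums gives a sum over all maps of indices; the permutations yield
    the Leibniz terms and the other maps contribute nonnegatively. *)
Lemma det_norm_le (F : numDomainType) n (B : 'M[F]_n) :
  `|\det B| <= \prod_i \sum_j `|B i j|.
Proof.
rewrite bigA_distr_bigA /=; apply: le_trans (ler_norm_sum _ _ _) _.
rewrite (eq_bigr (fun s : {perm 'I_n} => \prod_i `|B i (s i)|)); last first.
  by move=> s _; rewrite normrM normr_prod normrX normrN1 expr1n mul1r.
have injp : {in [set: {perm 'I_n}]%SET &,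
    injective (fun s : {perm 'I_n} => [ffun i => s i])}.
  move=> s t _ _ /ffunP st; apply/permP => i.
  by have := st i; rewrite !ffunE.
pose im := [set [ffun i => s i] | s : {perm 'I_n} in [set: {perm 'I_n}]]%SET.
rewrite [X in _ <= X](bigID (mem im)) /=.
rewrite (big_imset _ injp)/= -[X in X <= _]addr0 lerD//; last first.
  by apply: sumr_ge0 => f _; apply: prodr_ge0.
rewrite le_eqVlt; apply/orP; left; apply/eqP.
apply: eq_big => [s|s _]; first by rewrite inE.
by apply: eq_bigr => i _; rewrite ffunE.
Qed.

(** Multiplying row [k] by [D k] makes the matrix integral, so its determinant is an integer,
    bounded by the product of the scaled row sums. *)
Lemma scaled_det_bound n (B : 'M[rat]_n) (D s : 'I_n -> nat) :
  (forall k j, (D k)%:R * B k j \is a Num.int) ->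
  (forall k, (D k)%:R * \sum_j `|B k j| <= (2 ^ s k)%:R) ->
  exists2 N : int, (\prod_k D k)%:R * \det B = N%:~R
                 & (`|N| <= 2 ^ (\sum_k s k))%N.
Proof.
move=> Bint Bs; set B' := \matrix_(k, j) ((D k)%:R * B k j).
have detB' : (\prod_k D k)%:R * \det B = \det B'.
  rewrite /determinant mulr_sumr; apply: eq_bigr => t _.
  rewrite mulrCA natr_prod -big_split /=; congr (_ * _).
  by apply: eq_bigr => k _; rewrite mxE.
have /intrP[N detN] : \det B' \is a Num.int.
  apply: rpred_sum => t _; rewrite rpredMsign; apply: rpred_prod => k _.
  by rewrite mxE.
exists N; first by rewrite detB'.
rewrite -(ler_nat rat) natr_absz intr_norm -detN expn_sum natr_prod.
apply: le_trans (det_norm_le _) _.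
apply: ler_prod => k _; rewrite sumr_ge0//=.
apply: le_trans (Bs k); rewrite mulr_sumr; apply: ler_sum => j _.
by rewrite mxE normrM ger0_norm.
Qed.

(** Bounding [1 + |q|] instead of [|q|] lets the bounds be multiplied along a row, since the product
    of such factors dominates the row sum. *)
Lemma rat_size_bound (q : rat) :
  (`|denq q|%N)%:R * (1 + `|q|) <= (2 ^ rat_size q)%:R :> rat.
Proof.
have h : (`|denq q| * (1 + `|numq q|) <= 2 ^ rat_size q)%N.
  rewrite /rat_size /int_size mulnC addnACA expnD -[X in (X <= _)%N]mul1n leq_mul//.
  rewrite expnD leq_mul//; first exact: up_logP.
  by apply: leq_trans (leqnSn _) _; exact: up_logP.
rewrite -(ler_nat rat) in h; apply: le_trans h.
rewrite natrM ler_wpM2l// natrD lerD2l.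
rewrite -{1}(divq_num_den q) normrM normfV natr_absz intr_norm.
rewrite ler_pdivrMr ?normr_gt0 ?intr_eq0 ?denq_neq0// ler_peMr// -intr_norm.
by rewrite ler1z; have := denq_gt0 q; lia.
Qed.

Section RowBounds.
Context (m n : nat) (A : 'M[rat]_(m, n)) (b : 'cV[rat]_m).

(** A product of denominators rather than their least common multiple: its factors pair with the
    factors [1 + |A i j|] in [row_size_bound]. *)
Definition row_den (i : 'I_m) : nat :=
  ((\prod_(j < n) `|denq (A i j)|) * `|denq (b i ord0)|)%N.

Definition row_size (i : 'I_m) : nat :=
  (\sum_(j < n) rat_size (A i j) + rat_size (b i ord0))%N.

Lemma row_den_gt0 i : (0 < row_den i)%N.
Proof.
by rewrite muln_gt0 prodn_gt0/= ?absz_gt0 ?denq_neq0// => j; rewrite absz_gt0 denq_neq0.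
Qed.

Lemma denq_mul_int (q : rat) : (`|denq q|%N)%:R * q \is a Num.int.
Proof.
by rewrite mulrC -{1}(divq_num_den q) natr_absz gtr0_norm ?denq_gt0//
  divfK ?intr_eq0 ?denq_neq0//.
Qed.

Lemma row_den_intA i j : (row_den i)%:R * A i j \is a Num.int.
Proof.
rewrite /row_den (bigD1 j)//= !natrM mulrAC rpredM// ?natr_int//.
by rewrite mulrAC rpredM// ?natr_int// denq_mul_int.
Qed.

Lemma row_den_intb i : (row_den i)%:R * b i ord0 \is a Num.int.
Proof. by rewrite /row_den natrM -mulrA rpredM ?natr_int ?denq_mul_int. Qed.

Lemma sum_le_prod1D (F : realDomainType) (I : finType) (x : I -> F) :
  (forall i, 0 <= x i) -> 1 + \sum_i x i <= \prod_i (1 + x i).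
Proof.
move=> x0; suff : 1 + \sum_i x i <= \prod_i (1 + x i) /\ 0 <= \sum_i x i by case.
elim/big_rec2: _ => [|i s p _ [ih s0]]; first by rewrite addr0.
split; last by rewrite addr_ge0.
apply: (@le_trans _ _ ((1 + x i) * (1 + s))).
  by have := mulr_ge0 (x0 i) s0; lra.
by rewrite ler_wpM2l// addr_ge0.
Qed.

Lemma row_size_bound i :
  (row_den i)%:R * (\sum_j `|A i j| + `|b i ord0|) <= (2 ^ row_size i)%:R :> rat.
Proof.
apply: (@le_trans _ _ ((row_den i)%:R *
    ((\prod_j (1 + `|A i j|)) * (1 + `|b i ord0|)))).
  rewrite ler_wpM2l// mulrDr mulr1.
  have p1 := sum_le_prod1D (fun j => normr_ge0 (A i j)).
  have s0 : 0 <= \sum_j `|A i j| by apply: sumr_ge0.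
  have := normr_ge0 (b i ord0); set B := `|_|; set S := \sum_j _; set Q := \prod_j _.
  by move: p1 s0; rewrite -/S -/Q; clear; nra.
rewrite /row_den /row_size expnD !natrM mulrACA ler_pM//.
- by rewrite mulr_ge0//; apply: prodr_ge0 => j _; rewrite addr_ge0.
- rewrite natr_prod expn_sum natr_prod -big_split/=.
  apply: ler_prod => j _; rewrite rat_size_bound andbT.
  by rewrite mulr_ge0// addr_ge0.
- exact: rat_size_bound.
Qed.

Lemma sum_row_size (f : 'I_n -> 'I_m) : injective f ->
  (\sum_k row_size (f k) <= mx_size A + mx_size b)%N.
Proof.
move=> finj; apply: (@leq_trans (\sum_i row_size i)).
  rewrite [X in (_ <= X)%N](bigID (fun i => i \in f @: 'I_n)%SET)/=.
  by rewrite (big_imset _ (in2W finj))/= leq_addr.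
rewrite /row_size big_split /mx_size leq_add ?leq_addl//.
by apply: leq_trans (leq_addl _ _); apply: leq_sum => i _; rewrite big_ord1.
Qed.

(** Both determinants in Cramer's rule are scaled by the same product of row denominators, which
    cancels. As [f] is injective each row is charged once, so the exponents add up to at most the
    size of the system. *)
Lemma rational_solution_size (f : 'I_n -> 'I_m) (x : 'cV[rat]_n) i :
  injective f -> \det (rowsub f A) != 0 -> rowsub f A *m x = rowsub f b ->
  exists N D : int, [/\ x i ord0 = N%:~R / D%:~R, D != 0,
    (`|N| <= 2 ^ (mx_size A + mx_size b))%N &
    (`|D| <= 2 ^ (mx_size A + mx_size b))%N].
Proof.
move=> finj detA Ax.
pose Q := (\prod_k row_den (f k))%N.
have Q0 : Q%:R != 0 :> rat.
  by rewrite pnatr_eq0 -lt0n prodn_gt0// => k; exact: row_den_gt0.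
have s0 k : 0 <= \sum_j `|A (f k) j| by apply: sumr_ge0.
have [|k|D eD lD] := @scaled_det_bound _ (rowsub f A) (row_den \o f) (row_size \o f).
- by move=> k j; rewrite !mxE; exact: row_den_intA.
- apply: le_trans (row_size_bound _); rewrite ler_wpM2l//.
  by under eq_bigr do rewrite !mxE; rewrite lerDl.
set B := \matrix_(k, j) (if j == i then rowsub f b k ord0 else rowsub f A k j).
have [|k|N eN lN] := @scaled_det_bound _ B (row_den \o f) (row_size \o f).
- move=> k j; rewrite !mxE; case: ifP => _; first exact: row_den_intb.
  exact: row_den_intA.
- apply: le_trans (row_size_bound _); rewrite ler_wpM2l//.
  rewrite (bigD1 i)//= !mxE eqxx addrC lerD2r.
  rewrite [X in _ <= X](bigD1 i)//= ler_wpDl//.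
  by apply: ler_sum => j /negbTE ji; rewrite !mxE ji.
have hs := sum_row_size finj.
have D0 : D%:~R != 0 :> rat by rewrite -eD mulf_neq0.
exists N, D; split.
- apply: (canRL (mulfK D0)); rewrite -eN -eD -(cramer i Ax).
  by rewrite mulrC -mulrA.
- by rewrite -(intr_eq0 rat).
- by apply: leq_trans lN _; rewrite leq_exp2l.
- by apply: leq_trans lD _; rewrite leq_exp2l.
Qed.

End RowBounds.

(** * Slopes of concave functions *)

Section Concave.
Context (R : realType) (S : set R) (f : R -> R).
Hypothesis Sconvex : forall x y z, S x -> S z -> x <= y <= z -> S y.
Hypothesis fconcave : concave_on S f.

Lemma concave_onP x y t : S x -> S y -> 0 <= t <= 1 ->
  t * f x + (1 - t) * f y <= f (t * x + (1 - t) * y).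
Proof.
move=> Sx Sy /andP[t0 t1].
have := fconcave (Itv01 t0 t1) (mem_set Sx) (mem_set Sy).
by rewrite !convRE /= mulrN mulrN -opprD lerN2.
Qed.

Lemma concave_three_points x y z : S x -> S z -> x <= y <= z ->
  (z - y) * f x + (y - x) * f z <= (z - x) * f y.
Proof.
move=> Sx Sz /andP[xy yz].
have [xz|xz] := eqVneq x z.
  have -> : y = x by apply/eqP; rewrite eq_le xy xz yz.
  by rewrite xz !subrr !mul0r addr0.
have d0 : 0 < z - x by rewrite subr_gt0 lt_neqAle xz (le_trans xy).
have t01 : 0 <= (z - y) / (z - x) <= 1.
  rewrite divr_ge0 ?subr_ge0 ?(le_trans xy)//= ler_pdivrMr// mul1r.
  by rewrite lerD2l lerN2.
have := concave_onP Sx Sz t01.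
have -> : (z - y) / (z - x) * x + (1 - (z - y) / (z - x)) * z = y.
  by field; rewrite gt_eqF.
rewrite -(ler_pM2l d0); congr (_ <= _).
by field; rewrite gt_eqF.
Qed.

Lemma interior_between x y z : S x -> S z -> x < y < z -> S^° y.
Proof.
move=> Sx Sz /andP[xy yz].
rewrite /interior; apply: (@filterS _ _ _ `]x, z[%classic); last first.
  apply: near_in_itvoo.
  by rewrite in_itv/= xy yz.
move=> w /=; rewrite in_itv/= => /andP[h1 h2].
by apply: (Sconvex Sx Sz); rewrite !ltW.
Qed.

Lemma interior_nbhs p : S^° p -> exists2 r, 0 < r & forall h, `|h| < r -> S (p + h).
Proof.
move=> /nbhs_ballP[r /= r0 hr]; exists r => // h hh; apply: hr.
by rewrite /ball/= opprD addNKr normrN.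
Qed.

Let dq p h : R := h^-1 * (f (p + h) - f p).

(** If the derivative exists, the right difference quotients inherit its two-sided limit; otherwise
    they converge because concavity makes them monotone and bounded. Both branches of [slope] thus
    become one limit. *)
Lemma slope_lim p : S^° p -> dq p h @[h --> 0^'+] --> slope f p.
Proof.
move=> Sp; have [r r0 hr] := interior_nbhs Sp.
have Sh h : 0 <= h < r -> S (p + h).
  by move=> /andP[h0 hlt]; apply: hr; rewrite ger0_norm.
rewrite /slope; case: asboolP => [df|_].
  apply: cvg_dnbhs_at_right; rewrite derive1E.
  have E : (fun h => h^-1 *: ((f \o shift p) (h *: (1 : R)) - f p)) = dq p.
    by apply/funext => h; rewrite /dq /= [h *: _]mulr1 (addrC h).
  by move: df; rewrite /derivable /derive E.
apply: nonincreasing_at_right_is_cvgr.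
  near=> x => h k; rewrite !in_itv/= => /andP[h0 hx] /andP[k0 kx] hk.
  have xr : x < r by near: x; exact: nbhs_right_lt.
  have := @concave_three_points p (p + h) (p + k).
  rewrite /dq ler_pdivrMl// mulrCA ler_pdivlMl//.
  have Sp0 : S p by rewrite -(addr0 p); apply: Sh; rewrite lexx.
  have Sk : S (p + k) by apply: Sh; rewrite (ltW k0) (lt_trans kx).
  have ord : p <= p + h <= p + k by rewrite lerDl (ltW h0)/= lerD2l.
  by move/(_ Sp0 Sk ord); lra.
(* The slope of the chord from [p - r / 2] to [p] bounds all right difference quotients from
   above. *)
have Sr : S (p - r / 2).
  by apply: hr; rewrite normrN ger0_norm ?divr_ge0 ?ltW// ltr_pdivrMr//; lra.
near=> x; exists ((f p - f (p - r / 2)) / (r / 2)) => _ [h /= + <-].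
rewrite in_itv/= => /andP[h0 hx].
have xr : x < r by near: x; exact: nbhs_right_lt.
have Sk : S (p + h) by apply: Sh; rewrite (ltW h0) (lt_trans hx).
have ord : p - r / 2 <= p <= p + h by lra.
have := concave_three_points Sr Sk ord.
by rewrite /dq ler_pdivrMl// mulrA ler_pdivlMr ?divr_gt0//; lra.
Unshelve. all: by end_near.
Qed.

(** For [x < p] the slope of the chord from [x] to [p] bounds the right difference quotients from
    above; for [x > p] it bounds those with small step from below. Both bounds pass to the limit. *)
Lemma slope_supergradient p x : S^° p -> S x -> f x <= tangent f p x.
Proof.
move=> Sp Sx; have [r r0 hr] := interior_nbhs Sp.
have Sp0 : S p by rewrite -(addr0 p); apply: hr; rewrite normr0.
have slim := slope_lim Sp; rewrite /tangent.
have [xp|px|->] := ltgtP x p; last by rewrite subrr mulr0 addr0.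
- suff : slope f p <= (f p - f x) / (p - x).
    by rewrite ler_pdivlMr ?subr_gt0//; lra.
  apply: (cvgr_to_le slim); near=> h.
  have h0 : 0 < h by near: h; exact: nbhs_right_gt.
  have hr' : h < r by near: h; exact: nbhs_right_lt.
  have Sh : S (p + h) by apply: hr; rewrite gtr0_norm.
  have ord : x <= p <= p + h by rewrite (ltW xp)/= lerDl ltW.
  have := concave_three_points Sx Sh ord.
  by rewrite /dq ler_pdivrMl// mulrA ler_pdivlMr ?subr_gt0//; lra.
- suff : (f x - f p) / (x - p) <= slope f p.
    by rewrite ler_pdivrMr ?subr_gt0//; lra.
  apply: (cvgr_to_ge slim); near=> h.
  have h0 : 0 < h by near: h; exact: nbhs_right_gt.
  have hx : h < x - p by near: h; apply: nbhs_right_lt; rewrite subr_gt0.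
  have ord : p <= p + h <= x by lra.
  have := concave_three_points Sp0 Sx ord.
  by rewrite /dq ler_pdivlMl// mulrA ler_pdivrMr ?subr_gt0//; lra.
Unshelve. all: by end_near.
Qed.

End Concave.

Lemma largestP (P : nat -> Prop) N : P 0%N -> (forall j, P j -> (j <= N)%N) ->
  P (largest P) /\ forall j, P j -> (j <= largest P)%N.
Proof.
move=> P0 PN; rewrite /largest.
apply: (@xgetPex _ 0%N [set k | P k /\ forall j, P j -> (j <= k)%N]).
have exP : exists k, `[< P k >] by exists 0%N; apply/asboolP.
have ubP k : `[< P k >] -> (k <= N)%N by move=> /asboolP; exact: PN.
case: (ex_maxnP exP ubP) => k /asboolP Pk kmax.
by exists k; split=> // j Pj; apply: kmax; apply/asboolP.
Qed.

(** Bernoulli's inequality reduces geometric to linear growth, and the Archimedean property supplies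
    [N]. This bounds the index sets to which [largest] is applied. *)
Lemma geometric_bounded (R : realType) (a l x hi : R) : 0 < l -> 1 < x ->
  exists N, forall j, a + l * x ^+ j <= hi -> (j <= N)%N.
Proof.
move=> l0 x1; have d0 : 0 < x - 1 by rewrite subr_gt0.
have bern j : 1 + j%:R * (x - 1) <= x ^+ j.
  elim: j => [|j IH]; first by rewrite mul0r addr0 expr0.
  rewrite exprS (le_trans _ (ler_wpM2l (ltW (lt_trans ltr01 x1)) IH))//.
  rewrite -natr1; have := mulr_ge0 (ler0n R j) (sqr_ge0 (x - 1)); nra.
have [N hN] : exists N : nat, (hi - a) / l / (x - 1) < N%:R.
  exists (Num.bound `|(hi - a) / l / (x - 1)|).
  by rewrite (le_lt_trans (ler_norm _))// archi_boundP.
exists N => j hj; rewrite -(ler_nat R); apply: le_trans (ltW hN).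
rewrite ler_pdivlMr// ler_pdivlMr// mulrC -lerBlDr opprK addrC (le_trans _ hj)//.
by rewrite lerD2l ler_wpM2l ?(ltW l0)// (le_trans _ (bern j))// lerDr.
Qed.

(** * Tangents at geometrically spaced points *)

Section TangentCover.
Context (R : realType) (D E : set R) (f s : R -> R) (a e : R).
Hypothesis e0 : 0 < e.
Hypothesis ED : E `<=` D.
Hypothesis Da : D a.
Hypothesis f0 : forall x, D x -> 0 <= f x.
(** An arbitrary supergradient [s] replaces [slope] so that the results also apply to the reflected
    function: reflection turns a right derivative into a left one. *)
Hypothesis supergradient : forall p x, E p -> D x -> f x <= f p + s p * (x - p).

Let good w p := f p + s p * (w - p) <= (1 + e) * f w.

Lemma supergradient_antitone x y : E x -> E y -> x <= y -> s y <= s x.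
Proof.
move=> Ex Ey; rewrite le_eqVlt => /predU1P[->//|xy].
have h1 := supergradient Ex (ED Ey); have h2 := supergradient Ey (ED Ex).
have : 0 <= (s x - s y) * (y - x) by lra.
by rewrite pmulr_lge0 ?subr_gt0// subr_ge0.
Qed.

(* If both tangents exceed [(1 + e) * f w], then the chord bound at [w] makes the
   quadratic [(1 + e) * x ^+ 2 - d * x + e * d * u] negative for [x := w - p],
   [d := p' - p] and [u := p - a], while its discriminant
   [d * (d - 4 * e * (1 + e) * u)] is nonpositive: this is where [ratio] comes
   from. *)
Lemma two_tangents p p' w : E p -> E p' -> E w -> a < p -> p <= w <= p' ->
  p' - a <= (p - a) * ratio e -> 0 <= s p' -> good w p \/ good w p'.
Proof.
have e_gt0 := e0.
move=> Ep Ep' Ew ap /andP[pw wp'] hr sp'; rewrite /good.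
have fw := f0 (ED Ew).
have [pp'|pp'] := eqVneq p p'.
  left; have -> : w = p by apply/eqP; rewrite eq_le pw pp' wp'.
  by rewrite subrr mulr0 addr0 ler_peMl ?lerDl ?(ltW e0)// f0//; exact: ED.
have [g1|g1] := leP (f p + s p * (w - p)) ((1 + e) * f w); first by left.
have [g2|g2] := leP (f p' + s p' * (w - p')) ((1 + e) * f w); first by right.
exfalso.
have c1 := supergradient Ew (ED Ep); have c2 := supergradient Ew (ED Ep').
have c3 := supergradient Ep Da; have fa := f0 Da.
set F := f w in fw g1 g2 c1 c2 *.
move: hr; rewrite /ratio.
pose u := p - a; pose x := w - p; pose d := p' - p.
have u0 : 0 < u by rewrite subr_gt0.
have x0 : 0 <= x by rewrite subr_ge0.
have dx : 0 <= d - x by rewrite /d /x; lra.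
have d0 : 0 < d by rewrite subr_gt0 lt_neqAle pp' (le_trans pw).
move=> hr; have du : d <= 4 * e * (1 + e) * u by rewrite /d /u; lra.
have ux0 : 0 < u + x by rewrite ltr_pwDl.
(* Weighting the failed bound at [p] by [u] and the nonnegativity of the tangent at [a] by [x]
   eliminates [s p]. *)
have k1 : 0 < f p * (u + x) - (1 + e) * F * u.
  have t1 : 0 < u * (f p + s p * (w - p) - (1 + e) * F) by rewrite mulr_gt0// subr_gt0.
  have t2 : 0 <= x * (f p - s p * u) by rewrite mulr_ge0// /u; lra.
  by move: t1 t2; rewrite /u /x; lra.
have k2 : 0 < f p' - (1 + e) * F.
  have : 0 <= s p' * (p' - w) by rewrite mulr_ge0// subr_ge0.
  lra.
have k3 : (d - x) * f p + x * f p' <= d * F.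
  have t1 := ler_wpM2l dx c1; have t2 := ler_wpM2l x0 c2.
  by move: t1 t2; rewrite /d /x; lra.
(* Completing the square: [4 * (1 + e)] times the quadratic is the sum of the terms in [t1] and
   [t2]. *)
have q0 : 0 <= e * d * u + (1 + e) * x ^+ 2 - d * x.
  have t1 : 0 <= d * (4 * e * (1 + e) * u - d) by rewrite mulr_ge0 ?(ltW d0)// subr_ge0.
  have t2 := sqr_ge0 (2 * (1 + e) * x - d).
  have e1 : 0 < 4 * (1 + e) by lra.
  by rewrite -(pmulr_rge0 _ e1); lra.
(* The weights [d - x] and [x * (u + x)] on [k1] and [k2] match the left side of [k3] times [u + x];
   what remains says that [F] times the quadratic is negative. *)
have t1 := ler_wpM2l (ltW ux0) k3.
have t2 := mulr_ge0 fw q0.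
have t3 : 0 < (d - x) * (f p * (u + x) - (1 + e) * F * u)
              + x * (u + x) * (f p' - (1 + e) * F).
  move: x0; rewrite le_eqVlt => /predU1P[x0|x0].
    by rewrite -x0 !mul0r addr0 subr0 mulr_gt0//; move: k1; rewrite -x0.
  by rewrite ltr_wpDl// ?mulr_ge0 ?mulr_gt0// ltW.
lra.
Qed.

Section Left.
Context (l hi w : R) (Q r : nat).
Let lp k := a + l * ratio e ^+ k.
Let fine t := a + l * ratio e ^+ Q * (1 + e) ^+ t.
Let z := Num.min hi (lp Q.+1).
Hypothesis l0 : 0 < l.
Hypothesis lohi : forall x, a + l <= x <= hi -> E x.
Hypothesis lpQ : lp Q <= hi /\ 0 <= s (lp Q).
Hypothesis Qmaximal : forall j, lp j <= hi /\ 0 <= s (lp j) -> (j <= Q)%N.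
Hypothesis finer : s z < 0 -> (E (fine r) /\ 0 <= s (fine r)) /\
  forall j, E (fine j) /\ 0 <= s (fine j) -> (j <= r)%N.
Hypothesis wlohi : a + l <= w <= hi.
Hypothesis sw : 0 <= s w.

(** Up to [lp Q], [w] lies between two consecutive points; from there to the extra point, between
    [lp Q] and that point. Both cases are [two_tangents]. Past [fine r] the tangent there suffices
    alone, as [w] is less than a factor [1 + e] farther from [a]. *)
Lemma left_tangents_cover :
  (exists2 k, (k <= Q)%N & good w (lp k)) \/
  good w (if 0 <= s z then z else fine r).
Proof.
have e_gt0 := e0.
have q1 : 1 < ratio e by rewrite /ratio; nra.
have q0 : 0 < ratio e by exact: lt_trans q1.
have lp_mono i j : (i <= j)%N -> lp i <= lp j.
  by move=> ij; rewrite lerD2l ler_pM2l// ler_eXn2l.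
have lpS k : lp k.+1 - a = (lp k - a) * ratio e.
  by rewrite /lp exprSr; lra.
have lp0 : lp 0%N = a + l by rewrite /lp expr0 mulr1.
have alp k : a < lp k by rewrite ltrDl mulr_gt0// exprn_gt0.
have Elp k : (k <= Q)%N -> E (lp k).
  by move=> kQ; apply: lohi; rewrite -lp0 lp_mono//= (le_trans (lp_mono _ _ kQ)) ?lpQ.1.
have Ew := lohi wlohi.
have slp k : (k <= Q)%N -> 0 <= s (lp k).
  move=> kQ; apply: le_trans lpQ.2 _.
  by apply: supergradient_antitone; rewrite ?lp_mono//; apply: Elp.
have [wQ|wQ] := leP w (lp Q).
  left; have : forall N, (N <= Q)%N -> w <= lp N ->
      exists2 k, (k <= Q)%N & good w (lp k).
    elim=> [_ w0|N IH NQ wN].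
      exists 0%N => //; have -> : lp 0%N = w.
        by apply/eqP; rewrite eq_le w0 lp0 andbT; case/andP: wlohi.
      by rewrite /good subrr mulr0 addr0 ler_peMl ?lerDl ?(ltW e0)// f0//; exact: ED.
    have [wN'|wN'] := leP w (lp N); first exact: IH (ltnW NQ) wN'.
    have [||g|g] := @two_tangents (lp N) (lp N.+1) w
      (Elp _ (ltnW NQ)) (Elp _ NQ) Ew (alp N) _ _ (slp _ NQ).
    - by rewrite (ltW wN').
    - by rewrite lpS.
    - by exists N => //; exact: ltnW.
    - by exists N.+1.
  by move=> /(_ Q (leqnn Q) wQ).
have lpQz : lp Q <= z by rewrite le_min lpQ.1 lp_mono.
have Ez : E z.
  by apply: lohi; rewrite -lp0 (le_trans (lp_mono _ _ (leq0n Q)) lpQz)/= ge_min lexx.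
have zS : z <= lp Q.+1 by rewrite ge_min lexx orbT.
have two p' : E p' -> p' <= lp Q.+1 -> 0 <= s p' -> w <= p' ->
    (exists2 k, (k <= Q)%N & good w (lp k)) \/ good w p'.
  move=> Ep' p'S sp' wp'.
  have [||g|g] := @two_tangents (lp Q) p' w (Elp _ (leqnn Q)) Ep' Ew (alp Q) _ _ sp'.
  - by rewrite (ltW wQ).
  - by rewrite -lpS lerD2r.
  - by left; exists Q.
  - by right.
have [sz|sz] := leP 0 (s z).
  (* Were [w] beyond [z], then [z] would be [lp Q.+1], below [hi] and of nonnegative slope, against
     the maximality of [Q]. *)
  apply: two => //; case/andP: wlohi => _ wh; rewrite le_min wh/=.
  rewrite leNgt; apply/negP => h.
  have zE : z = lp Q.+1.
    by rewrite /z; apply/min_idPr; apply: ltW; exact: lt_le_trans h wh.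
  have := Qmaximal (conj (ltW (lt_le_trans h wh)) _).
  by rewrite -zE => /(_ sz); rewrite ltnn.
have [[Ef sf] fmax] := finer sz.
have fz : fine r <= z.
  rewrite leNgt; apply/negP => h.
  by have := supergradient_antitone Ez Ef (ltW h); lra.
have [wf|wf] := leP w (fine r); first by apply: two => //; exact: le_trans fz zS.
right.
have fS : fine r.+1 - a = (fine r - a) * (1 + e).
  by rewrite /fine exprSr; lra.
have fa : 0 < fine r - a.
  by rewrite /fine addrAC subrr add0r !mulr_gt0// ?exprn_gt0//; lra.
(* Otherwise the next fine point would have at least the slope of [w], which is nonnegative, against
   the maximality of [r]. *)
have wfS : w < fine r.+1.
  rewrite ltNge; apply/negP => h.
  have Efs : E (fine r.+1).
    apply: lohi; rewrite (le_trans h) ?andbT; last by case/andP: wlohi.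
    rewrite (@le_trans _ _ (fine r))//; last by nra.
    rewrite -lp0 (le_trans (lp_mono _ _ (leq0n Q)))//.
    have lq : 0 <= l * ratio e ^+ Q by rewrite mulr_ge0 ?exprn_ge0// ltW.
    by rewrite lerD2l ler_peMr// exprn_ege1// lerDl ltW.
  have sfs : 0 <= s (fine r.+1).
    exact: le_trans sw (supergradient_antitone Efs Ew h).
  by have := fmax _ (conj Efs sfs); rewrite ltnn.
(* The tangent at [fine r] is nonnegative at [a], so it rises by at most [e * f (fine r)] up to [w];
   and [f (fine r) <= f w] since [s w] is nonnegative. *)
have c1 := supergradient Ew (ED Ef); have c2 := supergradient Ef Da.
have fa0 := f0 Da; rewrite /good.
have c3 : s w * (fine r - w) <= 0 by rewrite mulr_ge0_le0//; lra.
have c4 : s (fine r) * (w - fine r) <= e * (s (fine r) * (fine r - a)).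
  by rewrite mulrCA ler_wpM2l//; lra.
have c5 : e * (s (fine r) * (fine r - a)) <= e * f (fine r).
  by rewrite ler_wpM2l ?(ltW e_gt0)//; lra.
have c6 : (1 + e) * f (fine r) <= (1 + e) * f w by rewrite ler_wpM2l//; lra.
lra.
Qed.

End Left.
End TangentCover.

(** * The piecewise-linear function *)

Lemma seq_minP (R : realType) (s : seq R) : s != [::] ->
  (forall y, y \in s -> seq_min s <= y) /\ seq_min s \in s.
Proof.
case: s => // x t _; rewrite /seq_min /=.
elim: t x => [|y t IH] x.
  by rewrite big_nil; split; [move=> y; rewrite inE => /eqP-> | rewrite mem_head].
have [IH1 IH2] := IH x; rewrite big_cons /=; set b := \big[_/_]_(_ <- _) _ in IH1 IH2 *.
split=> [z|].
  rewrite !inE => /or3P[/eqP->|/eqP->|zt].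
  - by rewrite ge_min IH1 ?mem_head ?orbT.
  - by rewrite ge_min lexx.
  - by rewrite ge_min IH1 ?orbT// inE zt orbT.
rewrite minEle; case: ifP => _; first by rewrite !inE eqxx orbT.
by move: IH2; rewrite !inE => /orP[->//|->]; rewrite !orbT.
Qed.

Lemma convex_combination_between (R : realFieldType) (x y t : R) :
  x < y -> 0 < t -> 0 < 1 - t -> x < t * x + (1 - t) * y < y.
Proof. by move=> xy t0 t1; apply/andP; split; nra. Qed.

Section PiecewiseLinear.
Context (R : realType) (S : set R) (V W : nat) (phi : R -> R) (e : R).
Hypothesis e0 : 0 < e.
Hypothesis Sconvex : forall x y z, S x -> S z -> x <= y <= z -> S y.
Hypothesis phi_concave : concave_on S phi.
Hypothesis phi0 : forall x, S x -> 0 <= phi x.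
Hypothesis Salpha : S (alpha S V).
Hypothesis Sbeta : S (beta S V).
Hypothesis ell0 : 0 < ell S V W.
Hypothesis compat : compatible S V W.

Notation al := (alpha S V).
Notation be := (beta S V).
Notation l' := (ell' S V W).
Notation u' := (upp' S V W).
Notation sl := (slope phi).

Lemma ell'_gt0 : 0 < l'.
Proof. by rewrite /ell' lt_max ell0. Qed.

(** [ell'] and [upp'] are the ends of the intersection of the two intervals, measured from [alpha];
    measured from [beta] they describe the same window, so both families of tangents share it. *)
Lemma right_end : be - l' = al + u'.
Proof.
by rewrite /ell' /upp'; case: leP => h1; case: leP => h2; lra.
Qed.

Lemma left_end : be - u' = al + l'.
Proof. by have := right_end; lra. Qed.

Lemma window_in : al < al + l' /\ al + l' <= al + u' /\ al + u' < be.
Proof.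
split; first by rewrite ltrDl ell'_gt0.
split; last by rewrite -right_end gtrDl oppr_lt0 ell'_gt0.
have [x /= [/[!in_itv]/= /andP[h1 h2] /andP[h3 h4]]] := compat.
rewrite lerD2l /ell' /upp' ge_max !le_min; lra.
Qed.

Lemma window_interior (x : R) : al + l' <= x <= al + u' -> S^° x.
Proof.
move=> /andP[h1 h2]; have [w1 [w2 w3]] := window_in.
apply: (interior_between Sconvex Salpha Sbeta); rewrite (lt_le_trans w1)//=.
exact: le_lt_trans h2 w3.
Qed.

Lemma slope_antitone x y : S^° x -> S^° y -> x <= y -> sl y <= sl x.
Proof.
apply: (supergradient_antitone (@interior_subset _ S)).
exact: (slope_supergradient phi_concave).
Qed.

Lemma ratio_gt1 : 1 < ratio e.
Proof. by have := e0; rewrite /ratio; nra. Qed.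

Section LeftPoints.
Hypothesis slope_lo : 0 <= sl (al + l').

Lemma QmaxP :
  (lpt S V W e (Qmax S V W phi e) <= al + u' /\
     0 <= sl (lpt S V W e (Qmax S V W phi e))) /\
  forall j, lpt S V W e j <= al + u' /\ 0 <= sl (lpt S V W e j) ->
    (j <= Qmax S V W phi e)%N.
Proof.
have [N hN] := geometric_bounded al (al + u') ell'_gt0 ratio_gt1.
apply: (@largestP _ N) => [|j [hj _]]; last exact: hN.
by rewrite /lpt expr0 mulr1; have [_ [w2 _]] := window_in.
Qed.

Lemma lpt_ge k : al + l' <= lpt S V W e k.
Proof.
rewrite /lpt lerD2l ler_peMr ?(ltW ell'_gt0)// exprn_ege1//.
exact: ltW ratio_gt1.
Qed.

Lemma lpt_interior k : (k <= Qmax S V W phi e)%N -> S^° (lpt S V W e k).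
Proof.
move=> kQ; apply: window_interior; rewrite lpt_ge/=.
apply: le_trans QmaxP.1.1; rewrite lerD2l ler_pM2l ?ell'_gt0//.
by rewrite ler_eXn2l// ratio_gt1.
Qed.

Lemma zeta_interior : S^° (zeta S V W phi e).
Proof.
apply: window_interior; rewrite /zeta le_min ge_min lexx lpt_ge !andbT.
by have [_ [w2 _]] := window_in.
Qed.

(** The slope is negative at [zeta], hence at every later interior point, so only fine points up to
    [zeta] can qualify. *)
Lemma rmaxP : sl (zeta S V W phi e) < 0 ->
  (S^° (lpt_fine S V W phi e (rmax S V W phi e)) /\
     0 <= sl (lpt_fine S V W phi e (rmax S V W phi e))) /\
  forall j, S^° (lpt_fine S V W phi e j) /\ 0 <= sl (lpt_fine S V W phi e j) ->
    (j <= rmax S V W phi e)%N.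
Proof.
move=> sz.
have lq : 0 < l' * ratio e ^+ Qmax S V W phi e.
  by rewrite mulr_gt0 ?ell'_gt0// exprn_gt0// (lt_trans _ ratio_gt1).
have e1 : 1 < 1 + e by rewrite ltrDl.
have [N hN] := geometric_bounded al (zeta S V W phi e) lq e1.
apply: (@largestP _ N) => [|j [Sj sj]].
  rewrite /lpt_fine expr0 mulr1; split; last exact: QmaxP.1.2.
  exact: lpt_interior.
apply: hN; rewrite leNgt; apply/negP => h.
have := le_trans sj (slope_antitone zeta_interior Sj (ltW h)).
by rewrite leNgt sz.
Qed.

End LeftPoints.

Lemma left_points_interior p : p \in left_points S V W phi e -> S^° p.
Proof.
rewrite /left_points; case: ifP => // slo; rewrite mem_rcons inE.
move=> /predU1P[->|/mapP[k]].
  case: ifPn => [_|]; first exact: zeta_interior.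
  by rewrite -ltNge => sz; have [[]] := rmaxP slo sz.
by rewrite mem_iota add0n ltnS => kQ ->; exact: lpt_interior.
Qed.

Lemma left_points_cover (w : R) : al + l' <= w <= al + u' -> 0 <= sl w ->
  exists2 p, p \in left_points S V W phi e & tangent phi p w <= (1 + e) * phi w.
Proof.
move=> wlohi sw.
have slo : 0 <= sl (al + l').
  have [w1 [w2 w3]] := window_in; apply: le_trans sw (slope_antitone _ _ _).
  - by apply: window_interior; rewrite lexx.
  - exact: window_interior.
  - by case/andP: wlohi.
rewrite /left_points slo.
have [[k kQ gk]|gP] := left_tangents_cover e0 (@interior_subset _ S) Salpha phi0
  (fun p x Sp Sx => slope_supergradient phi_concave Sp Sx) ell'_gt0
  window_interior (QmaxP slo).1 (QmaxP slo).2 (rmaxP slo) wlohi sw.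
  exists (lpt S V W e k) => //; rewrite mem_rcons inE; apply/orP; right.
  by apply/mapP; exists k => //; rewrite mem_iota.
by exists (if 0 <= sl (zeta S V W phi e) then zeta S V W phi e
   else lpt_fine S V W phi e (rmax S V W phi e)) => //; rewrite mem_rcons mem_head.
Qed.

Section RightPoints.
Hypothesis slope_hi : sl (be - l') <= 0.

Lemma RmaxP :
  (be - u' <= rpt S V W e (Rmax S V W phi e) /\
     sl (rpt S V W e (Rmax S V W phi e)) <= 0) /\
  forall j, be - u' <= rpt S V W e j /\ sl (rpt S V W e j) <= 0 ->
    (j <= Rmax S V W phi e)%N.
Proof.
have [N hN] := geometric_bounded (- be) (- (be - u')) ell'_gt0 ratio_gt1.
apply: (@largestP _ N) => [|j [hj _]]; last first.
  by apply: hN; move: hj; rewrite -lerN2 /rpt opprB addrC.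
rewrite /rpt expr0 mulr1; have [_ [w2 _]] := window_in.
by split=> //; rewrite left_end right_end.
Qed.

Lemma rpt_le k : rpt S V W e k <= al + u'.
Proof.
rewrite -right_end /rpt lerD2l lerN2 ler_peMr ?(ltW ell'_gt0)// exprn_ege1//.
exact: ltW ratio_gt1.
Qed.

Lemma rpt_interior k : (k <= Rmax S V W phi e)%N -> S^° (rpt S V W e k).
Proof.
move=> kQ; apply: window_interior; rewrite rpt_le andbT -left_end.
apply: le_trans RmaxP.1.1 _; rewrite lerD2l lerN2 ler_pM2l ?ell'_gt0//.
by rewrite ler_eXn2l// ratio_gt1.
Qed.

Lemma eta_interior : S^° (eta S V W phi e).
Proof.
apply: window_interior; rewrite /eta ge_max le_max left_end lexx rpt_le !andbT.
by have [_ [w2 _]] := window_in.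
Qed.

Lemma tmaxP : 0 < sl (eta S V W phi e) ->
  (S^° (rpt_fine S V W phi e (tmax S V W phi e)) /\
     sl (rpt_fine S V W phi e (tmax S V W phi e)) <= 0) /\
  forall j, S^° (rpt_fine S V W phi e j) /\ sl (rpt_fine S V W phi e j) <= 0 ->
    (j <= tmax S V W phi e)%N.
Proof.
move=> sz.
have lq : 0 < l' * ratio e ^+ Rmax S V W phi e.
  by rewrite mulr_gt0 ?ell'_gt0// exprn_gt0// (lt_trans _ ratio_gt1).
have e1 : 1 < 1 + e by rewrite ltrDl.
have [N hN] := geometric_bounded (- be) (- eta S V W phi e) lq e1.
apply: (@largestP _ N) => [|j [Sj sj]].
  rewrite /rpt_fine expr0 mulr1; split; last exact: RmaxP.1.2.
  exact: rpt_interior.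
apply: hN; rewrite leNgt; apply/negP => h.
have h' : rpt_fine S V W phi e j <= eta S V W phi e.
  by rewrite -lerN2 /rpt_fine opprB addrC ltW.
have := le_trans (slope_antitone Sj eta_interior h') sj.
by rewrite leNgt sz.
Qed.

End RightPoints.

Lemma right_points_interior p : p \in right_points S V W phi e -> S^° p.
Proof.
rewrite /right_points; case: ifP => // slo; rewrite mem_rcons inE.
move=> /predU1P[->|/mapP[k]].
  case: ifPn => [_|]; first exact: eta_interior.
  by rewrite -ltNge => sz; have [[]] := tmaxP slo sz.
by rewrite mem_iota add0n ltnS => kQ ->; exact: rpt_interior.
Qed.

(* The reflection [x |-> - x] turns [phi] into a function with supergradient
   [- slope phi (- x)] and the right points into left points. *)
Lemma right_points_cover (w : R) : al + l' <= w <= al + u' -> sl w <= 0 ->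
  exists2 p, p \in right_points S V W phi e & tangent phi p w <= (1 + e) * phi w.
Proof.
move=> wlohi sw.
have shi : sl (be - l') <= 0.
  have [w1 [w2 w3]] := window_in; apply: le_trans (slope_antitone _ _ _) sw.
  - exact: window_interior.
  - by apply: window_interior; rewrite right_end lexx andbT.
  - by rewrite right_end; case/andP: wlohi.
rewrite /right_points shi.
pose D : set R := [set x | S (- x)]; pose E : set R := [set x | S^° (- x)].
pose f x := phi (- x); pose s x := - sl (- x).
have ED : E `<=` D by move=> x; exact: interior_subset.
have Da : D (- be) by rewrite /D/= opprK.
have f0 x : D x -> 0 <= f x by exact: phi0.
have sg p x : E p -> D x -> f x <= f p + s p * (x - p).
  move=> Ep Dx; have := slope_supergradient phi_concave Ep Dx.
  have tE : sl (- p) * (- x - - p) = s p * (x - p) by rewrite /s; ring.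
  by rewrite /tangent tE.
have hi_in x : - be + l' <= x <= - be + u' -> E x.
  move=> /andP[h1 h2]; apply: window_interior; rewrite -left_end -right_end.
  by rewrite lerNr opprB addrC h2 lerNl opprB addrC h1.
have lpE k : - be + l' * ratio e ^+ k = - rpt S V W e k.
  by rewrite /rpt opprB addrC.
have hiE : - be + u' = - (be - u') by rewrite opprB addrC.
have fineE t : - be + l' * ratio e ^+ Rmax S V W phi e * (1 + e) ^+ t
    = - rpt_fine S V W phi e t.
  by rewrite /rpt_fine opprB addrC.
have zE : Num.min (- be + u') (- be + l' * ratio e ^+ (Rmax S V W phi e).+1)
    = - eta S V W phi e.
  by rewrite lpE hiE -oppr_max.
have sN x : s (- x) = - sl x by rewrite /s opprK.
have [[RM1 RM2] RM3] := RmaxP shi.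
have rmQ : - be + l' * ratio e ^+ Rmax S V W phi e <= - be + u' /\
    0 <= s (- be + l' * ratio e ^+ Rmax S V W phi e).
  by rewrite lpE sN hiE lerN2 oppr_ge0.
have rmax' j : - be + l' * ratio e ^+ j <= - be + u' /\
    0 <= s (- be + l' * ratio e ^+ j) -> (j <= Rmax S V W phi e)%N.
  by rewrite lpE sN hiE lerN2 oppr_ge0; exact: RM3.
have finer :
  s (Num.min (- be + u') (- be + l' * ratio e ^+ (Rmax S V W phi e).+1)) < 0 ->
   (E (- be + l' * ratio e ^+ Rmax S V W phi e * (1 + e) ^+ tmax S V W phi e) /\
    0 <= s (- be + l' * ratio e ^+ Rmax S V W phi e * (1 + e) ^+ tmax S V W phi e)) /\
   forall j, E (- be + l' * ratio e ^+ Rmax S V W phi e * (1 + e) ^+ j) /\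
    0 <= s (- be + l' * ratio e ^+ Rmax S V W phi e * (1 + e) ^+ j) ->
    (j <= tmax S V W phi e)%N.
  rewrite zE sN oppr_lt0 => /(tmaxP shi)[[T1 T2] T3]; split.
    by rewrite fineE sN oppr_ge0 /E/= opprK.
  by move=> j; rewrite fineE sN oppr_ge0 /E/= opprK; exact: T3.
have wN : - be + l' <= - w <= - be + u'.
  move: wlohi; rewrite -left_end -right_end => /andP[h1 h2].
  by rewrite lerNr opprD opprK h2 hiE lerN2 h1.
have swN : 0 <= s (- w) by rewrite sN oppr_ge0.
have tgE p : f (- p) + s (- p) * (- w - - p) = tangent phi p w.
  by rewrite /f sN /tangent opprK; congr (_ + _); ring.
have fw : f (- w) = phi w by rewrite /f opprK.
have [[k kQ]|] := left_tangents_cover e0 ED Da f0 sg ell'_gt0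
  hi_in rmQ rmax' finer wN swN.
  rewrite lpE tgE fw => gk.
  exists (rpt S V W e k) => //; rewrite mem_rcons inE; apply/orP; right.
  by apply/mapP; exists k => //; rewrite mem_iota.
rewrite zE sN oppr_ge0 fineE -(fun_if -%R) tgE fw => gP.
by exists (if sl (eta S V W phi e) <= 0 then eta S V W phi e
   else rpt_fine S V W phi e (tmax S V W phi e)) => //; rewrite mem_rcons mem_head.
Qed.

Lemma tangent_points_interior p : p \in tangent_points S V W phi e -> S^° p.
Proof.
rewrite /tangent_points !mem_cat => /or3P[].
- exact: left_points_interior.
- exact: right_points_interior.
- by rewrite mem_filter => /andP[/asboolP].
Qed.

Lemma tangent_points_cover (w : R) : al + l' <= w <= al + u' ->
  exists2 p, p \in tangent_points S V W phi e & tangent phi p w <= (1 + e) * phi w.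
Proof.
move=> wlohi; have [sw|sw] := leP 0 (sl w).
  have [p pl pw] := left_points_cover wlohi sw; exists p => //.
  by rewrite mem_cat pl.
have [p pl pw] := right_points_cover wlohi (ltW sw); exists p => //.
by rewrite !mem_cat pl orbT.
Qed.

Lemma tangent_values_neq0 x :
  [seq tangent phi p x | p <- tangent_points S V W phi e] != [::].
Proof.
have [_ [w2 _]] := window_in.
have [|p pin _] := @tangent_points_cover (al + l'); first by rewrite lexx.
by case: (tangent_points _ _ _ _ _) pin.
Qed.

Lemma seq_min_tangent_le p x : p \in tangent_points S V W phi e ->
  seq_min [seq tangent phi p x | p <- tangent_points S V W phi e] <= tangent phi p x.
Proof.
by move=> pin; apply: (seq_minP (tangent_values_neq0 x)).1; apply: map_f.
Qed.

Lemma seq_min_tangentE x : exists2 p, p \in tangent_points S V W phi e &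
  seq_min [seq tangent phi p x | p <- tangent_points S V W phi e] = tangent phi p x.
Proof. by have /mapP[p pin ->] := (seq_minP (tangent_values_neq0 x)).2; exists p. Qed.

(** Where [psi] is set to [phi] at an endpoint of [S], it still lies below every tangent by the
    supergradient inequality; concavity of [psi] rests on this. *)
Lemma psi_le_tangent p x : S x -> p \in tangent_points S V W phi e ->
  psi S V W phi e x <= tangent phi p x.
Proof.
move=> Sx pin; rewrite /psi; case: asboolP => _; last exact: seq_min_tangent_le.
by apply: (slope_supergradient phi_concave) => //; exact: tangent_points_interior.
Qed.

Lemma le_psi x : S x -> phi x <= psi S V W phi e x.
Proof.
move=> Sx; rewrite /psi; case: asboolP => // _.
have [p pin ->] := seq_min_tangentE x.
by apply: (slope_supergradient phi_concave) => //; exact: tangent_points_interior.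
Qed.

(** A proper combination of distinct points is interior, where [psi] equals one of the tangents;
    that tangent is affine and dominates [psi] at both points. A drop of [psi] at the endpoints of
    [S] therefore does no harm. *)
Lemma psi_concave x y (t : R) : S x -> S y -> 0 <= t <= 1 ->
  t * psi S V W phi e x + (1 - t) * psi S V W phi e y
    <= psi S V W phi e (t * x + (1 - t) * y).
Proof.
move=> Sx Sy /andP[t0 t1].
have [->|nt0] := eqVneq t 0; first by rewrite !mul0r !add0r subr0 !mul1r.
have [->|nt1] := eqVneq t 1; first by rewrite !mul1r !subrr !mul0r !addr0.
have [->|xy] := eqVneq x y; first by rewrite -!mulrDl addrC subrK !mul1r.
have tp : 0 < t by rewrite lt_neqAle eq_sym nt0.
have tq : 0 < 1 - t by rewrite subr_gt0 lt_neqAle nt1.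
have intz : S^° (t * x + (1 - t) * y).
  have [lt|gt|/eqP] := ltgtP x y; last by rewrite (negbTE xy).
  - by apply: (interior_between Sconvex Sx Sy); exact: convex_combination_between.
  - have tq' : 0 < 1 - (1 - t) by rewrite opprB addrC subrK.
    have -> : t * x + (1 - t) * y = (1 - t) * y + (1 - (1 - t)) * x by ring.
    by apply: (interior_between Sconvex Sy Sx); exact: convex_combination_between.
rewrite [leRHS]/psi; case: asboolP => [[_ []]//|_].
have [p pin ->] := seq_min_tangentE (t * x + (1 - t) * y).
have -> : tangent phi p (t * x + (1 - t) * y)
    = t * tangent phi p x + (1 - t) * tangent phi p y by rewrite /tangent; ring.
by rewrite lerD// ler_pM2l// psi_le_tangent.
Qed.

Lemma psi_le_window (x : R) : al + l' <= x <= al + u' ->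
  psi S V W phi e x <= (1 + e) * phi x.
Proof.
move=> xw; have [p pin] := tangent_points_cover xw; apply: le_trans.
by apply: psi_le_tangent => //; exact: interior_subset (window_interior xw).
Qed.

Lemma psi_endpoint x : x = al \/ x = be -> ~ S^° x ->
  psi S V W phi e x = phi x.
Proof. by move=> xe nx; rewrite /psi; case: asboolP => // -[]. Qed.

End PiecewiseLinear.

(** * Location of the coordinates of basic points *)

(** Meant for quotients of determinants, hence neither reduced nor with a positive denominator. *)
Definition bounded_fraction (R : realType) (K : nat) (x : R) :=
  exists N D : int, [/\ x = N%:~R / D%:~R, D != 0,
    (`|N| <= 2 ^ K)%N & (`|D| <= 2 ^ K)%N].

Lemma fraction_norm_le (R : realType) K (x : R) :
  bounded_fraction K x -> `|x| <= 2 ^+ K.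
Proof.
move=> [N [D [-> D0 hN _]]].
rewrite normrM normfV ler_pdivrMr ?normr_gt0 ?intr_eq0//.
have h1 : `|N%:~R| <= 2 ^+ K :> R.
  by rewrite -intr_norm -natr_absz -natrX ler_nat.
apply: le_trans h1 _; rewrite ler_peMr ?exprn_ge0//.
by rewrite -intr_norm ler1z; move: D0; lia.
Qed.

(** Over the common denominator [D * D'] the numerator of the difference is a nonzero integer, so at
    least 1 in absolute value. *)
Lemma fraction_gap (R : realType) K L (x y : R) :
  bounded_fraction K x -> bounded_fraction L y -> x != y ->
  (2 ^+ (K + L))^-1 <= `|x - y|.
Proof.
move=> [N [D [-> D0 _ hD]]] [N' [D' [-> D'0 _ hD']]] xy.
have d0 : D%:~R != 0 :> R by rewrite intr_eq0.
have d0' : D'%:~R != 0 :> R by rewrite intr_eq0.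
have E : N%:~R / D%:~R - N'%:~R / D'%:~R
    = (N * D' - N' * D)%:~R / (D * D')%:~R :> R.
  by rewrite rmorphB !rmorphM/=; field; rewrite d0 d0'.
have n0 : N * D' - N' * D != 0.
  by apply: contra xy => /eqP h; rewrite -subr_eq0 E h mul0r.
rewrite E normrM normfV -[X in X <= _]mul1r ler_pM ?invr_ge0 ?exprn_ge0//.
  by rewrite -intr_norm ler1z; move: n0; lia.
rewrite lef_pV2 ?posrE ?exprn_gt0// ?normr_gt0 ?intr_eq0 ?mulf_neq0//.
rewrite -intr_norm -natr_absz -natrX ler_nat abszM expnD.
exact: leq_mul.
Qed.

Section BasicFraction.
Context (R : realType) (m n : nat) (A : 'M[rat]_(m, n)) (b : 'cV[rat]_m).

Lemma polyhedronE : polyhedron A b =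
  [set x : 'cV[R]_n | forall i,
     (map_mx ratr A *m x) i ord0 <= map_mx ratr b i ord0].
Proof.
by apply/seteqP; split=> x h i; have := h i; rewrite [map_mx ratr b _ _]mxE.
Qed.

(** The square system that determines a basic point is the image of a rational one, so the point is
    the image of a rational solution. *)
Lemma basic_bounded_fraction (x : 'cV[R]_n) i :
  basic (map_mx ratr A) (map_mx ratr b) x ->
  bounded_fraction (mx_size A + mx_size b) (x i ord0).
Proof.
move=> /basicP[f [finj uf xE]].
pose y := invmx (rowsub f A) *m rowsub f b.
have uA : rowsub f A \in unitmx.
  by move: uf; rewrite -map_mxsub map_unitmx.
have Ay : rowsub f A *m y = rowsub f b by rewrite /y mulKVmx.
have detA : \det (rowsub f A) != 0 by move: uA; rewrite unitmxE unitfE.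
have [N [D [yE D0 hN hD]]] := rational_solution_size i finj detA Ay.
exists N, D; split=> //.
have -> : x = map_mx ratr y.
  by rewrite xE /basis_point /y map_mxM map_invmx !map_mxsub.
by rewrite mxE yE fmorph_div /= !ratr_int.
Qed.

Lemma mx_size_gt0 : row_full (map_mx ratr A : 'M[R]_(m, n)) -> (0 < n)%N ->
  (0 < mx_size A + mx_size b)%N.
Proof.
move=> /eqP Afull n0; have := rank_leq_row (map_mx ratr A : 'M[R]_(m, n)).
rewrite Afull => nm; rewrite addn_gt0 /mx_size addn_gt0 muln_gt0 n0.
by rewrite (leq_trans n0 nm).
Qed.

End BasicFraction.

Section Coordinate.
Context (R : realType) (S : set R) (K L : nat).
Hypothesis K0 : (0 < K)%N.
Hypothesis L0 : (0 < L)%N.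
Hypothesis Sconvex : forall x y z, S x -> S z -> x <= y <= z -> S y.
Hypothesis Sinf : has_lbound S -> S (inf S) /\ bounded_fraction L (inf S).
Hypothesis Ssup : has_ubound S -> S (sup S) /\ bounded_fraction L (sup S).

Let V := (4 * K)%N.
Let W := (4 * L)%N.
Hypothesis compat : compatible S V W.

Notation al := (alpha S V).
Notation be := (beta S V).

(** The factor 4 in [system_size] provides this slack: the artificial ends lie well beyond every
    coordinate of a basic point. *)
Lemma pow_pred_ge J : (0 < J)%N -> 4 * 2 ^+ J <= 2 ^+ (4 * J).-1 :> R.
Proof.
move=> J0; have -> : (4 * J).-1 = (2 + (J + (3 * J - 3)))%N by lia.
rewrite exprD; have -> : 2 ^+ 2 = 4 :> R by rewrite -natrX.
by rewrite ler_pM2l// exprD ler_peMr ?exprn_ge0// exprn_ege1// ler1n.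
Qed.

Lemma pow_gt1 J : (0 < J)%N -> 2 <= 2 ^+ J :> R.
Proof. by move=> J0; rewrite -{1}(expr1 2) ler_eXn2l// ltr1n. Qed.

(** The upper bound is the least gap that [fraction_gap] allows between a coordinate and a finite
    endpoint, so [ell] is a safe margin. *)
Lemma not_setT_ell : S <> setT -> 0 < ell S V W <= (2 ^+ (K + L))^-1.
Proof.
move=> nT; rewrite /ell; case: asboolP => // _; rewrite div1r.
have h : 2 ^+ (K + L) <= 2 ^+ (V + W).-1 - 1 :> R.
  have -> : 2 ^+ (V + W).-1 = 2 ^+ (K + L) * (2 * 2 ^+ (3 * K + 3 * L - 2)) :> R.
    by rewrite -exprS -exprD; congr (_ ^+ _); rewrite /V /W; lia.
  have h1 : 1 <= 2 ^+ (K + L) :> R by rewrite exprn_ege1// ler1n.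
  have h2 : 1 <= 2 ^+ (3 * K + 3 * L - 2) :> R by rewrite exprn_ege1// ler1n.
  have h3 := ler_wpM2l (le_trans ler01 h1) h2.
  lra.
have p0 : 0 < 2 ^+ (K + L) :> R by rewrite exprn_gt0.
rewrite invr_gt0 (lt_le_trans p0 h)/= lef_pV2 ?posrE//.
exact: lt_le_trans h.
Qed.

Lemma ell_gt0 : 0 < ell S V W.
Proof.
have [ST|/not_setT_ell/andP[]//] := pselect (S = setT).
by rewrite /ell; case: asboolP => // _; rewrite exprn_gt0.
Qed.

Lemma alpha_lt_beta : al < be.
Proof.
have [x /= [/[!in_itv]/= /andP[h1 h2] /andP[h3 h4]]] := compat.
apply: (@lt_trans _ _ x).
  by apply: lt_le_trans h1; rewrite ltrDl ell_gt0.
by apply: le_lt_trans h4 _; rewrite gtrDl oppr_lt0 ell_gt0.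
Qed.

Lemma unbounded_setT : ~ has_lbound S -> ~ has_ubound S -> S = setT.
Proof.
move=> nl nu; apply/seteqP; split=> // x _.
have [y Sy yx] : exists2 y, S y & y < x.
  apply/not_exists2P => h; apply: nl; exists x => y Sy.
  by have [//|/negP] := h y; rewrite -leNgt.
have [z Sz xz] : exists2 z, S z & x < z.
  apply/not_exists2P => h; apply: nu; exists x => z Sz.
  by have [//|/negP] := h z; rewrite -leNgt.
by apply: (Sconvex Sy Sz); rewrite !ltW.
Qed.

Lemma alpha_inf : has_lbound S -> al = inf S.
Proof.
move=> lb; rewrite /alpha; case: asboolP => [ST|_]; last by case: asboolP.
by case: lb => x; rewrite ST => /(_ (x - 1) I); lra.
Qed.

Lemma beta_sup : has_ubound S -> be = sup S.
Proof.
move=> ub; rewrite /beta; case: asboolP => [ST|_]; last by case: asboolP.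
by case: ub => x; rewrite ST => /(_ (x + 1) I); lra.
Qed.

(** On a half-line unbounded below [alpha] is artificial, but it lies between a point of [S] below
    it and [beta], which belongs to [S]; [compatible] gives [al < be]. *)
Lemma alpha_in : S al.
Proof.
have [lb|nl] := pselect (has_lbound S); first by
  rewrite alpha_inf//; exact: (Sinf lb).1.
have [ub|nu] := pselect (has_ubound S); last by rewrite (unbounded_setT nl nu).
have Sb := (Ssup ub).1; rewrite -(beta_sup ub) in Sb.
have [y Sy yal] : exists2 y, S y & y < al.
  apply/not_exists2P => h; apply: nl; exists al => y Sy.
  by have [//|/negP] := h y; rewrite -leNgt.
by apply: (Sconvex Sy Sb); rewrite (ltW yal) (ltW alpha_lt_beta).
Qed.

Lemma beta_in : S be.
Proof.
have [ub|nu] := pselect (has_ubound S); first by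
  rewrite beta_sup//; exact: (Ssup ub).1.
have [lb|nl] := pselect (has_lbound S); last by rewrite (unbounded_setT nl nu).
have Sa := (Sinf lb).1; rewrite -(alpha_inf lb) in Sa.
have [y Sy yal] : exists2 y, S y & be < y.
  apply/not_exists2P => h; apply: nu; exists be => y Sy.
  by have [//|/negP] := h y; rewrite -leNgt.
by apply: (Sconvex Sa Sy); rewrite (ltW yal) (ltW alpha_lt_beta).
Qed.

Lemma inf_not_interior : has_lbound S -> ~ S^° (inf S).
Proof.
move=> lb /interior_nbhs[r r0 hr].
have : S (inf S + - (r / 2)) by apply: hr; rewrite normrN ger0_norm; lra.
by move=> /(ge_inf lb); lra.
Qed.

Lemma sup_not_interior : has_ubound S -> ~ S^° (sup S).
Proof.
move=> ub /interior_nbhs[r r0 hr].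
have : S (sup S + r / 2) by apply: hr; rewrite ger0_norm; lra.
by move=> /(ub_le_sup ub); lra.
Qed.

(** A coordinate other than a finite endpoint keeps distance [ell] from it by [fraction_gap]; the
    bounds [2 ^ K] and [2 ^ L] on absolute values give the remaining inequalities. On the whole line
    the absolute value of [w] alone suffices. *)
Lemma bounded_fraction_location w : S w -> bounded_fraction K w ->
  ((w = al \/ w = be) /\ ~ S^° w) \/
  al + ell' S V W <= w <= al + upp' S V W.
Proof.
move=> Sw wK.
suff : [\/ w = al /\ has_lbound S, w = be /\ has_ubound S |
    [/\ al + ell S V W <= w, be - upp S V W <= w, w <= al + upp S V W
      & w <= be - ell S V W]].
  case=> [[wa lb]|[wb ub]|[h1 h2 h3 h4]].
  - by left; split; [left|rewrite wa alpha_inf//; exact: inf_not_interior].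
  - by left; split; [right|rewrite wb beta_sup//; exact: sup_not_interior].
  - right; rewrite -lerBrDl -[X in _ && X]lerBlDl /ell' /upp' ge_max le_min.
    by apply/andP; split; apply/andP; split; lra.
have := fraction_norm_le wK; rewrite ler_norml => /andP[wl wu].
have TV := pow_pred_ge K0; have UW := pow_pred_ge L0.
have k2 := pow_gt1 K0; have g2 := pow_gt1 L0.
rewrite -/V in TV; rewrite -/W in UW.
have [ST|nT] := pselect (S = setT).
  apply: Or33.
  have -> : al = - (2 * 2 ^+ V.-1).
    rewrite /alpha; case: asboolP => // _; rewrite -exprS prednK//.
    by rewrite muln_gt0.
  have -> : be = 2 * 2 ^+ V.-1.
    rewrite /beta; case: asboolP => // _; rewrite -exprS prednK//.
    by rewrite muln_gt0.
  have -> : ell S V W = 2 ^+ V.-1 by rewrite /ell; case: asboolP.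
  have -> : upp S V W = 3 * 2 ^+ V.-1 by rewrite /upp; case: asboolP.
  set T := 2 ^+ V.-1 in TV *; set k := 2 ^+ K in TV wl wu k2.
  by split; lra.
have /andP[l0 l1] := not_setT_ell nT.
have -> : upp S V W = 2 ^+ V.-1 + 2 ^+ W.-1 - 1 by rewrite /upp; case: asboolP.
have gap1 : (2 ^+ (K + L))^-1 <= 1 :> R.
  by rewrite invf_le1 ?exprn_gt0// exprn_ege1// ler1n.
have alpha_norm : has_lbound S -> - 2 ^+ L <= al <= w.
  move=> lb; rewrite alpha_inf// ge_inf// andbT.
  by have := fraction_norm_le (Sinf lb).2; rewrite ler_norml => /andP[].
have beta_norm : has_ubound S -> w <= be <= 2 ^+ L.
  move=> ub; rewrite beta_sup// ub_le_sup//=.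
  by have := fraction_norm_le (Ssup ub).2; rewrite ler_norml => /andP[].
have above_alpha : has_lbound S -> w != al -> ell S V W <= w - al.
  move=> lb; have := alpha_norm lb; rewrite alpha_inf// => /andP[_ aw] wa.
  apply: le_trans l1 _; rewrite -(@ger0_norm _ (w - _)) ?subr_ge0//.
  exact: fraction_gap wK (Sinf lb).2 wa.
have below_beta : has_ubound S -> w != be -> ell S V W <= be - w.
  move=> ub; have := beta_norm ub; rewrite beta_sup// => /andP[bw _] wb.
  apply: le_trans l1 _; rewrite -(@ger0_norm _ (_ - w)) ?subr_ge0// distrC.
  exact: fraction_gap wK (Ssup ub).2 wb.
have [lb|nl] := pselect (has_lbound S); have [ub|nu] := pselect (has_ubound S).
- have [wa|wa] := eqVneq w al; first by apply: Or31.
  have [wb|wb] := eqVneq w be; first by apply: Or32.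
  have aw := above_alpha lb wa; have bw := below_beta ub wb.
  have ia := alpha_norm lb; have ib := beta_norm ub.
  apply: Or33; split; lra.
- have [wa|wa] := eqVneq w al; first by apply: Or31.
  have aw := above_alpha lb wa; have ia := alpha_norm lb.
  have -> : be = 2 ^+ V.-1.
    by rewrite /beta; case: asboolP => // _; case: asboolP.
  apply: Or33; split; lra.
- have [wb|wb] := eqVneq w be; first by apply: Or32.
  have bw := below_beta ub wb; have ib := beta_norm ub.
  have -> : al = - 2 ^+ V.-1.
    by rewrite /alpha; case: asboolP => // _; case: asboolP.
  apply: Or33; split; lra.
- by case: nT; exact: unbounded_setT.
Qed.

End Coordinate.

(** * Assembly *)

Section Assembly.
Context (R : realType) (m n : nat) (A : 'M[rat]_(m, n)) (b : 'cV[rat]_m).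

Let P : set 'cV[R]_n := polyhedron A b.
Let rbasic (x : 'cV[R]_n) := basic (map_mx ratr A) (map_mx ratr b) x.

Lemma polyhedron_convex (x y : 'cV[R]_n) t :
  P x -> P y -> 0 <= t <= 1 -> P (t *: x + (1 - t) *: y).
Proof.
move=> Px Py /andP[t0 t1] i; rewrite mulmxDr -!scalemxAr !mxE.
have := Px i; have := Py i; rewrite !mxE => hy hx.
have -> : ratr (b i ord0) = t * ratr (b i ord0) + (1 - t) * ratr (b i ord0) :> R.
  by ring.
by rewrite lerD// ler_wpM2l// subr_ge0.
Qed.

Lemma proj_convex i x y z :
  proj i P x -> proj i P z -> x <= y <= z -> proj i P y.
Proof.
move=> [p Pp <-] [q Pq <-] /andP[].
rewrite le_eqVlt => /predU1P[<- _|xy yz]; first by exists p.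
have d0 : 0 < q i ord0 - p i ord0 by rewrite subr_gt0 (lt_le_trans xy).
pose t := (q i ord0 - y) / (q i ord0 - p i ord0).
exists (t *: p + (1 - t) *: q).
  apply: polyhedron_convex => //.
  rewrite divr_ge0 ?subr_ge0// ?(ltW (lt_le_trans xy yz))//=.
  by rewrite ler_pdivrMr// mul1r lerD2l lerN2 ltW.
by rewrite !mxE /t; field; rewrite gt_eqF.
Qed.

Hypothesis Pvertex : exists v, vertex P v.

Lemma polyhedron_row_full : row_full (map_mx ratr A : 'M[R]_(m, n)).
Proof.
by have [v] := Pvertex; rewrite /P polyhedronE; exact: vertex_row_full.
Qed.

Lemma polyhedron_minimum (g : 'cV[R]_n -> R) B :
  concave_in P g -> (forall x, P x -> B <= g x) ->
  exists2 v, rbasic v & is_minimum P g (g v).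
Proof.
have PE := @polyhedronE R _ _ A b; rewrite -/P in PE.
have P0 : P !=set0 by have [v [Pv _]] := Pvertex; exists v.
rewrite PE in P0 *; move=> cg gB.
have [v bv vmin] := basic_minimum polyhedron_row_full cg gB P0.
by exists v => //; split=> //; exists v => //; case: bv.
Qed.

(** Used with [s] equal to 1 and to -1, so that both ends of a projection come from minimization. *)
Lemma coordinate_concave i (s : R) : concave_in P (fun x => s * x i ord0).
Proof.
move=> x y t _ _ _; rewrite !mxE le_eqVlt; apply/orP; left.
by apply/eqP; ring.
Qed.

Let K := (mx_size A + mx_size b)%N.

(** A coordinate bounded below attains its minimum at a basic point, so the endpoint belongs to the
    projection and inherits the bound on fractions. *)
Lemma proj_inf i : has_lbound (proj i P) ->
  proj i P (inf (proj i P)) /\ bounded_fraction K (inf (proj i P)).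
Proof.
move=> [B hB].
have [|v bv [_ vmin]] := polyhedron_minimum (@coordinate_concave i 1) (B := B).
  by move=> x Px; rewrite mul1r; apply: hB; exists x.
have Pv : proj i P (v i ord0).
  by exists v => //; have := bv.1; rewrite /P polyhedronE.
suff -> : inf (proj i P) = v i ord0 by split=> //; exact: basic_bounded_fraction.
apply/eqP; rewrite eq_le; apply/andP; split; first by apply: ge_inf => //; exists B.
apply: lb_le_inf; first by exists (v i ord0).
move=> _ [x Px <-]; have := vmin (1 * x i ord0); rewrite !mul1r; apply.
by exists x => //; rewrite mul1r.
Qed.

Lemma proj_sup i : has_ubound (proj i P) ->
  proj i P (sup (proj i P)) /\ bounded_fraction K (sup (proj i P)).
Proof.
move=> [B hB].
have [|v bv [_ vmin]] := polyhedron_minimum (@coordinate_concave i (-1)) (B := - B).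
  by move=> x Px; rewrite mulN1r lerN2; apply: hB; exists x.
have Pv : proj i P (v i ord0).
  by exists v => //; have := bv.1; rewrite /P polyhedronE.
suff -> : sup (proj i P) = v i ord0 by split=> //; exact: basic_bounded_fraction.
apply/eqP; rewrite eq_le; apply/andP; split; last by apply: ub_le_sup => //; exists B.
apply: ge_sup; first by exists (v i ord0).
move=> _ [x Px <-]; have := vmin (- x i ord0); rewrite mulN1r lerN2; apply.
by exists x => //; rewrite mulN1r.
Qed.

End Assembly.

Lemma separable_concave (R : realType) n (P Q : set 'cV[R]_n) (f : 'I_n -> R -> R) :
  P `<=` Q ->
  (forall i x y t, proj i Q x -> proj i Q y -> 0 <= t <= 1 ->
    t * f i x + (1 - t) * f i y <= f i (t * x + (1 - t) * y)) ->
  concave_in P (separable f).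
Proof.
move=> PQ fc x y t /PQ Qx /PQ Qy t01; rewrite /separable !mulr_sumr -big_split/=.
apply: ler_sum => i _; rewrite !mxE; apply: fc => //; first by exists x.
by exists y.
Qed.

Theorem theorem3 (R : realType) (m m' n : nat)
    (A : 'M[rat]_(m, n)) (b : 'cV[rat]_m)
    (C : 'M[rat]_(m', n)) (d : 'cV[rat]_m')
    (phi : 'I_n -> R -> R) (e : R) :
  let X : set 'cV[R]_n := polyhedron A b in
  let Y : set 'cV[R]_n := polyhedron C d in
  let V := system_size A b in
  let W := system_size C d in
  let phi_total := separable phi in
  let psi_total := separable (fun i => psi (proj i Y) V W (phi i) e) in
  0 < e ->
  (exists v, vertex X v) ->
  (exists v, vertex Y v) ->
  X `<=` Y ->
  (forall i, concave_on (proj i Y) (phi i)) ->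
  (forall i x, proj i Y x -> 0 <= phi i x) ->
  (forall i, compatible (proj i Y) V W) ->
  exists Zconc Zpwl : R,
    [/\ is_minimum X phi_total Zconc,
        is_minimum X psi_total Zpwl
      & Zconc <= Zpwl <= (1 + e) * Zconc].
Proof.
move=> X Y V W phi_total psi_total e0 Xvertex Yvertex XY phic phi0 compat.
(* Positivity is derived from the existence of a coordinate, as [n] may be 0. *)
have K0 (i : 'I_n) : (0 < mx_size A + mx_size b)%N.
  by apply: (mx_size_gt0 _ (polyhedron_row_full Xvertex)); exact: leq_trans (ltn_ord i).
have L0 (i : 'I_n) : (0 < mx_size C + mx_size d)%N.
  by apply: (mx_size_gt0 _ (polyhedron_row_full Yvertex)); exact: leq_trans (ltn_ord i).
have Yc i := @proj_convex R _ _ C d i.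
have Yinf i := @proj_inf _ _ _ C d Yvertex i.
have Ysup i := @proj_sup _ _ _ C d Yvertex i.
have Yal i := alpha_in (K0 i) (L0 i) (Yc i) (Yinf i) (Ysup i) (compat i).
have Ybe i := beta_in (K0 i) (L0 i) (Yc i) (Yinf i) (Ysup i) (compat i).
have l0 i := ell_gt0 (proj i Y) (K0 i) (L0 i).
have phi_psi x : X x -> phi_total x <= psi_total x.
  move=> Xx; apply: ler_sum => i _.
  apply: (le_psi e0 (Yc i) (phic i) (phi0 i) (Yal i) (Ybe i) (l0 i) (compat i)).
  by exists x => //; exact: XY.
have psi_phi v : basic (map_mx ratr A) (map_mx ratr b) v -> X v ->
    psi_total v <= (1 + e) * phi_total v.
  move=> bv Xv; rewrite /psi_total /phi_total /separable mulr_sumr.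
  apply: ler_sum => i _; have Yv : proj i Y (v i ord0) by exists v => //; exact: XY.
  have vK := basic_bounded_fraction i bv.
  have [[vend vint]|vwin] :=
    bounded_fraction_location (K0 i) (L0 i) (Yc i) (Yinf i) (Ysup i) Yv vK.
    by rewrite psi_endpoint// ler_peMl ?phi0// lerDl ltW.
  exact: (psi_le_window e0 (Yc i) (phic i) (phi0 i) (Yal i) (Ybe i) (l0 i) (compat i)).
have phi_ge0 x : X x -> 0 <= phi_total x.
  by move=> Xx; apply: sumr_ge0 => i _; apply: phi0; exists x => //; exact: XY.
have phi_conc : concave_in X phi_total.
  by apply: (separable_concave XY) => i x y t; exact: concave_onP.
have psi_conc : concave_in X psi_total.
  apply: (separable_concave XY) => i x y t.
  exact: (psi_concave e0 (Yc i) (phic i) (phi0 i) (Yal i) (Ybe i) (l0 i) (compat i)).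
have [v bv vmin] := polyhedron_minimum Xvertex phi_conc phi_ge0.
have [u bu umin] := polyhedron_minimum Xvertex psi_conc
  (fun x Xx => le_trans (phi_ge0 x Xx) (phi_psi x Xx)).
have Xv : X v by have := bv.1; rewrite /X polyhedronE.
have Xu : X u by have := bu.1; rewrite /X polyhedronE.
(* The lower bound compares the two functions at the minimizer [u] of [psi_total], the upper one at
   the basic minimizer [v] of [phi_total]. *)
exists (phi_total v), (psi_total u); split=> //; apply/andP; split.
  by apply: le_trans (phi_psi u Xu); apply: vmin.2; exists u.
by apply: le_trans (psi_phi v bv Xv); apply: umin.2; exists v.
Qed.
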